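(* Let $0<J_{min}\le J_{max}$ be given, let $k_1>0$ and $k_2>0$, and let $\Gamma^i(t)$ be the matrix function obtained from the dipole geomagnetic field along a circular orbit as described in the context. Assume that $\Gamma^i_{av}=\lim_{T\to\infty}\frac1T\int_0^T\Gamma^i(\tau)\,d\tau$ is positive definite, $\Gamma^i_{av}>0$. Then there exists $\epsilon^*>0$ such that for every inertia matrix $J$ (symmetric positive definite, $J\in\mathbb{R}^{3\times3}$) satisfying $$J_{min}\le\lambda_{min}(J)\le\lambda_{max}(J)=\|J\|\le J_{max}$$ and every $0<\epsilon<\epsilon^*$, the equilibrium $(q,\omega)=(\bar q,0)$, with $\bar q=[0\ 0\ 0\ 1]^T$, is locally exponentially stable for the closed-loop system on $\{q\in\mathbb{R}^4:\|q\|=1\}\times\mathbb{R}^3$ given by $$\dot q=W(q)\omega,\qquad J\dot\omega=-\omega^{\times}J\omega+A(q)\Gamma^i(t)A(q)^Tu,$$ with the proportional derivative control law $$u=-(\epsilon^2k_1q_v+\epsilon k_2\omega).$$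
   Context: Notation. $\|\cdot\|$ is the Euclidean norm of a vector and the induced 2-norm of a matrix; $\lambda_{min},\lambda_{max}$ are minimum and maximum eigenvalues; $I$ is the identity matrix. For $a\in\mathbb{R}^3$, $a^{\times}\in\mathbb{R}^{3\times 3}$ is the skew-symmetric matrix with $a^{\times}b=a\times b$ for all $b\in\mathbb{R}^3$. Attitude. A unit quaternion is $q=[q_1\ q_2\ q_3\ q_4]^T=[q_v^T\ q_4]^T$ with $q_v\in\mathbb{R}^3$, $\|q\|=1$; it represents the rotation of the body frame with respect to the inertial frame. $\omega\in\mathbb{R}^3$ is the angular rate in body frame. Define $$A(q)=(q_4^2-q_v^Tq_v)I+2q_vq_v^T-2q_4q_v^{\times},\qquad W(q)=\frac12\begin{bmatrix}q_4I+q_v^{\times}\\-q_v^T\end{bmatrix}.$$ Geomagnetic field. The spacecraft follows a circular orbit of radius $R>0$, orbital rate $n>0$, initial phase $\phi_0$, inclination $incl$ and right ascension of the ascending node $\Omega$. Its in-plane position is $x^p(t)=R\cos(nt+\phi_0)$, $y^p(t)=R\sin(nt+\phi_0)$, and its inertial position is $r^i(t)=R_z(\Omega)R_x(incl)[x^p(t)\ y^p(t)\ 0]^T$, where $$R_z(\Omega)=\begin{bmatrix}\cos\Omega&-\sin\Omega&0\\ \sin\Omega&\cos\Omega&0\\0&0&1\end{bmatrix},\quad R_x(incl)=\begin{bmatrix}1&0&0\\0&\cos(incl)&-\sin(incl)\\0&\sin(incl)&\cos(incl)\end{bmatrix}.$$ Let $\hat r^i(t)=r^i(t)/\|r^i(t)\|$.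 The Earth's dipole direction is $$\hat m^i(t)=[\sin\theta_m\cos(\omega_et+\alpha_0),\ \sin\theta_m\sin(\omega_et+\alpha_0),\ \cos\theta_m]^T,$$ with dipole coelevation $\theta_m$, Earth rotation rate $\omega_e=360.99$ deg/day, and initial right ascension $\alpha_0$. With total dipole strength $\mu_m>0$, the geomagnetic field at the spacecraft in the inertial frame is $$B^i(t)=\frac{\mu_m}{\|r^i(t)\|^3}\left[3(\hat m^i(t)^T\hat r^i(t))\hat r^i(t)-\hat m^i(t)\right],$$ and $$\Gamma^i(t)=(B^i(t)^{\times})(B^i(t)^{\times})^T=B^i(t)^TB^i(t)I-B^i(t)B^i(t)^T.$$ Each entry of $\Gamma^i(t)$ is a finite linear combination of sinusoidal functions of $t$ (and constants), so the average $\Gamma^i_{av}$ is well defined. Local exponential stability of an equilibrium $\bar x$ of a time-varying system means: there exist positive constants $c,k,\gamma$ such that for all initial times $t_0\ge0$ and all initial states in the state space with $\|x(t_0)-\bar x\|<c$, the solution satisfies $\|x(t)-\bar x\|\le k\|x(t_0)-\bar x\|e^{-\gamma(t-t_0)}$ for all $t\ge t_0$. *)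

(* Defs.v *)
From HB Require Import structures.
From mathcomp Require Import all_boot all_order all_algebra.
From mathcomp Require Import all_classical all_reals all_analysis.

Set Implicit Arguments.
Unset Strict Implicit.
Unset Printing Implicit Defensive.

Import Order.TTheory GRing.Theory Num.Theory.
Import numFieldNormedType.Exports.

Local Open Scope classical_set_scope.
Local Open Scope ring_scope.

Section LinearAlgebra.
Context {R : realType}.

Definition dotv n (u v : 'cV[R]_n) : R := (u^T *m v) 0 0.

(* The norm carried by the matrix normed module is the max norm, which is
   used here only through the topology it defines. *)
Definition enorm n (v : 'cV[R]_n) : R := Num.sqrt (dotv v v).

Definition opnorm m n (M : 'M[R]_(m, n)) : R :=
  sup [set enorm (M *m v) | v in [set v : 'cV[R]_n | enorm v <= 1]].

Definition lambda_min n (M : 'M[R]_n) : R := inf [set a | eigenvalue M a].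
Definition lambda_max n (M : 'M[R]_n) : R := sup [set a | eigenvalue M a].

Definition posdef n (M : 'M[R]_n) : Prop :=
  M^T = M /\ forall v : 'cV[R]_n, v != 0 -> 0 < dotv v (M *m v).

Definition vec3 (a b c : R) : 'cV[R]_3 := \col_i [:: a; b; c]`_i.

Definition mx33 (rows : seq (seq R)) : 'M[R]_3 :=
  \matrix_(i, j) (nth [::] rows i)`_j.

(* crossmx a *m b is the cross product of a and b. *)
Definition crossmx (a : 'cV[R]_3) : 'M[R]_3 :=
  let a1 := a (inord 0) 0 in
  let a2 := a (inord 1) 0 in
  let a3 := a (inord 2) 0 in
  mx33 [:: [::   0; - a3;   a2];
           [::  a3;    0; - a1];
           [:: - a2;  a1;    0]].

End LinearAlgebra.

Section Stability.
Context {R : realType} {n : nat}.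

(* A time-varying system on a state space S, possibly in implicit form:
   [dyn t x v] says that v is the velocity prescribed at time t in state x. *)
Implicit Types (S : set 'cV[R]_n) (dyn : R -> 'cV[R]_n -> 'cV[R]_n -> Prop).

(* x is a solution on [t0, +oo[ starting from x0; what x does before t0 is
   irrelevant, whence the separate treatment of the endpoint. *)
Definition solution S dyn (t0 : R) (x0 : 'cV[R]_n) (x : R -> 'cV[R]_n) : Prop :=
  [/\ x t0 = x0,
      {within `[t0, +oo[, continuous x},
      forall t, t0 <= t -> S (x t) &
      forall t, t0 < t -> derivable x t 1 /\ dyn t (x t) ('D_1 x t)].

Definition equilibrium S dyn (xbar : 'cV[R]_n) : Prop :=
  S xbar /\ forall t, dyn t xbar 0.

(* Forward completeness is part of the definition: for each initial state close
   to xbar some solution exists on all of [t0, +oo[, and every solution from it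
   obeys the exponential estimate. *)
Definition locally_exponentially_stable S dyn (xbar : 'cV[R]_n) : Prop :=
  equilibrium S dyn xbar /\
  exists c k gamma : R, [/\ 0 < c, 0 < k, 0 < gamma &
    forall (t0 : R) (x0 : 'cV[R]_n),
      0 <= t0 -> S x0 -> enorm (x0 - xbar) < c ->
      (exists x, solution S dyn t0 x0 x) /\
      (forall x, solution S dyn t0 x0 x ->
        forall t, t0 <= t ->
          enorm (x t - xbar) <=
            k * enorm (x0 - xbar) * expR (- gamma * (t - t0)))].

End Stability.

Section Geomagnetism.
Context {R : realType}.

(* All angles are in radians and all rates in radians per second. *)
Record dipole_orbit := DipoleOrbit {
  orb_radius : R;
  orb_rate : R;
  orb_phase : R;
  orb_incl : R;
  orb_raan : R;
  dip_coelevation : R;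
  dip_right_ascension : R;
  dip_strength : R
}.

(* 360.99 degrees per day, in radians per second *)
Definition earth_rate : R :=
  (360%:R + 99%:R / 100%:R) * (pi / 180%:R) / (24%:R * 60%:R * 60%:R).

Definition Rz (a : R) : 'M[R]_3 :=
  mx33 [:: [:: cos a; - sin a; 0];
           [:: sin a;   cos a; 0];
           [::     0;       0; 1]].

Definition Rx (a : R) : 'M[R]_3 :=
  mx33 [:: [:: 1;     0;       0];
           [:: 0; cos a; - sin a];
           [:: 0; sin a;   cos a]].

Implicit Types (p : dipole_orbit) (t : R).

Definition orb_position p t : 'cV[R]_3 :=
  let angle := orb_rate p * t + orb_phase p in
  Rz (orb_raan p) *m Rx (orb_incl p) *m
    vec3 (orb_radius p * cos angle) (orb_radius p * sin angle) 0.

Definition orb_direction p t : 'cV[R]_3 :=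
  (enorm (orb_position p t))^-1 *: orb_position p t.

Definition dip_direction p t : 'cV[R]_3 :=
  let th := dip_coelevation p in
  let angle := earth_rate * t + dip_right_ascension p in
  vec3 (sin th * cos angle) (sin th * sin angle) (cos th).

Definition geofield p t : 'cV[R]_3 :=
  let r := orb_direction p t in
  let m := dip_direction p t in
  (dip_strength p / enorm (orb_position p t) ^+ 3) *:
    ((3%:R * dotv m r) *: r - m).

Definition Gamma p t : 'M[R]_3 :=
  crossmx (geofield p t) *m (crossmx (geofield p t))^T.

(* The entries of Gamma are trigonometric polynomials in t, so the limits exist. *)
Definition Gamma_av p : 'M[R]_3 :=
  \matrix_(i, j) lim
    ((T^-1 * \int[lebesgue_measure]_(tau in `[0, T]) Gamma p tau i j)
       @[T --> +oo]).

End Geomagnetism.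
Arguments dipole_orbit : clear implicits.

Section ClosedLoop.
Context {R : realType}.

(* A quaternion is the column q = [q_v; q_4], scalar part last; a state of the
   closed loop is the column x = [q; omega]. *)
Implicit Types (q : 'cV[R]_(3 + 1)) (omega : 'cV[R]_3) (x : 'cV[R]_(3 + 1 + 3)).

Definition qvec q : 'cV[R]_3 := usubmx q.
Definition qscal q : R := dsubmx q 0 0.

Definition attitude_mx q : 'M[R]_3 :=
  (qscal q ^+ 2 - dotv (qvec q) (qvec q))%:M
  + 2%:R *: (qvec q *m (qvec q)^T)
  - (2%:R * qscal q) *: crossmx (qvec q).

Definition kinematic_mx q : 'M[R]_(3 + 1, 3) :=
  2%:R^-1 *: col_mx ((qscal q)%:M + crossmx (qvec q)) (- (qvec q)^T).

Definition pd_control (k1 k2 eps : R) q omega : 'cV[R]_3 :=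
  - ((eps ^+ 2 * k1) *: qvec q + (eps * k2) *: omega).

Definition attitude_space : set 'cV[R]_(3 + 1 + 3) :=
  [set x | enorm (usubmx x) = 1].

Definition closed_loop (G : R -> 'M[R]_3) (J : 'M[R]_3) (k1 k2 eps : R)
    (t : R) x (xdot : 'cV[R]_(3 + 1 + 3)) : Prop :=
  let q := usubmx x in
  let omega := dsubmx x in
  let u := pd_control k1 k2 eps q omega in
  usubmx xdot = kinematic_mx q *m omega /\
  J *m dsubmx xdot =
    - (crossmx omega *m J *m omega)
    + attitude_mx q *m G t *m (attitude_mx q)^T *m u.

Definition qbar : 'cV[R]_(3 + 1) := col_mx 0 1%:M.

Definition attitude_equilibrium : 'cV[R]_(3 + 1 + 3) := col_mx qbar 0.

End ClosedLoop.

(* Main.v *)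
Require Import Defs.
From mathcomp Require Import all_boot all_order all_algebra.
From mathcomp Require Import all_classical all_reals all_analysis.
From mathcomp Require Import ring lra.
Import Order.TTheory GRing.Theory Num.Theory.
Import numFieldNormedType.Exports.
Local Open Scope ring_scope.

(** Rescale the angular rate to [w = omega / eps] and let [z] be the vector
part of the quaternion.  Near the equilibrium the closed loop reads
[z' = eps * (w / 2 + ...)] and
[J w' = - eps * (Gamma t *m (k1 z + k2 w) + ...)], where the dots are quadratic
in the state, so for small [eps] the loop sees only the average [G] of
[Gamma].

The averaged loop has the Lyapunov function
[(k1 + delta k2) z.Gz + w.Jw / 2 + delta z.Jw], whose rate of change is [eps]
times the negative definite form
[- k2 w.Gw - delta k1 z.Gz + (delta / 2) w.Jw] if [delta] is small.  It
involves neither the inverse of [J] nor a commutation of [J] with [G], whence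
constants that depend on [J] only through its smallest and largest eigenvalue.
Averaging is performed on this function rather than on the equations: since
the entries of [Gamma] are trigonometric polynomials, [Gamma - G] has a
bounded primitive [Delta] ([Gamma_oscillation_primitive]), and adding
[eps * (w + delta z).Delta(k1 z + k2 w)] replaces [Gamma] by [G] in the rate, at
the price of terms of relative size [eps] ([lyapunov_rate_le]).  The nonlinear
terms are dominated close to the equilibrium ([slow_dynamics]).  The square of
one minus the scalar part of the quaternion is added to make the function
definite in all coordinates; on the unit sphere, near the equilibrium, this
term is bounded by [z.z].

A barrier argument ([barrier_exponential_decay]) turns the differential
inequality, valid near the equilibrium, into exponential decay for all times
([local_stability]).  Solutions exist for all times because the field with
clipped arguments is bounded and Lipschitz, so that Picard iteration converges
globally ([global_cauchy_lipschitz]), and because its solutions obey the same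
estimate and therefore never meet the clipping
([exponentially_stable_of_estimate]).

The eigenvalue bounds on [J] become bounds on its quadratic form by
[eigenvalue_rayleigh_inf]. *)

(** * Euclidean norms and symmetric matrices *)

Section EuclideanGeometry.
Context {R : realType}.

Section Dimension.
Context {n : nat}.
Implicit Types u v w : 'cV[R]_n.

Lemma dotvE u v : dotv u v = \sum_i u i 0 * v i 0.
Proof. by rewrite /dotv mxE; apply: eq_bigr => i _; rewrite mxE. Qed.

Lemma dotvC u v : dotv u v = dotv v u.
Proof. by rewrite !dotvE; apply: eq_bigr => i _; rewrite mulrC. Qed.

Lemma dotvDl u v w : dotv (u + v) w = dotv u w + dotv v w.
Proof. by rewrite !dotvE -big_split; apply: eq_bigr => i _; rewrite mxE mulrDl. Qed.

Lemma dotvDr u v w : dotv u (v + w) = dotv u v + dotv u w.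
Proof. by rewrite !(dotvC u) dotvDl. Qed.

Lemma dotvZl a u v : dotv (a *: u) v = a * dotv u v.
Proof. by rewrite !dotvE mulr_sumr; apply: eq_bigr => i _; rewrite mxE mulrA. Qed.

Lemma dotvZr a u v : dotv u (a *: v) = a * dotv u v.
Proof. by rewrite !(dotvC u) dotvZl. Qed.

Lemma dotvNr u v : dotv u (- v) = - dotv u v.
Proof. by rewrite -scaleN1r dotvZr mulN1r. Qed.

Lemma dotv_ge0 v : 0 <= dotv v v.
Proof. by rewrite dotvE sumr_ge0// => i _; rewrite -expr2 sqr_ge0. Qed.

Lemma dotv_gt0 v : v != 0 -> 0 < dotv v v.
Proof.
move=> v0; rewrite lt_def dotv_ge0 andbT; apply: contra v0.
rewrite dotvE psumr_eq0 => [/allP vi0|i _]; last by rewrite -expr2 sqr_ge0.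
apply/eqP/colP => i; rewrite mxE; apply/eqP.
by have := vi0 i (mem_index_enum i); rewrite -expr2 sqrf_eq0.
Qed.

Lemma enorm_ge0 v : 0 <= enorm v.
Proof. exact: sqrtr_ge0. Qed.

Lemma enorm_sqr v : enorm v ^+ 2 = dotv v v.
Proof. by rewrite sqr_sqrtr// dotv_ge0. Qed.

Lemma enorm_le v c : 0 <= c -> dotv v v <= c ^+ 2 -> enorm v <= c.
Proof. by move=> c0 vc; rewrite -(@ler_pXn2r _ 2)// ?nnegrE ?enorm_ge0// enorm_sqr. Qed.

Lemma enorm0 : enorm (0 : 'cV[R]_n) = 0.
Proof. by rewrite /enorm dotvE big1 ?sqrtr0// => i _; rewrite mxE mul0r. Qed.

Lemma enormZ a v : enorm (a *: v) = `|a| * enorm v.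
Proof. by rewrite /enorm dotvZl dotvZr mulrA -expr2 sqrtrM ?sqr_ge0// sqrtr_sqr. Qed.

Lemma enormN v : enorm (- v) = enorm v.
Proof. by rewrite -scaleN1r enormZ normrN1 mul1r. Qed.

Lemma enorm_gt0 v : v != 0 -> 0 < enorm v.
Proof. by move=> v0; rewrite sqrtr_gt0 dotv_gt0. Qed.

Lemma normr_coord_le_enorm v i : `|v i 0| <= enorm v.
Proof.
rewrite -sqrtr_sqr ler_wsqrtr// dotvE (bigD1 i)//= -expr2 lerDl sumr_ge0//.
by move=> j _; rewrite -expr2 sqr_ge0.
Qed.

Lemma enorm_unit v : v != 0 -> dotv ((enorm v)^-1 *: v) ((enorm v)^-1 *: v) = 1.
Proof.
move=> v0; rewrite dotvZl dotvZr -enorm_sqr.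
by have := enorm_gt0 _ v0; move: (enorm v) => a a0; field; rewrite gt_eqF.
Qed.

End Dimension.

Lemma dotv_mulmx m n (M : 'M[R]_(m, n)) u v : dotv u (M *m v) = dotv (M^T *m u) v.
Proof. by rewrite /dotv trmx_mul trmxK mulmxA. Qed.

Lemma dotv_sym n (M : 'M[R]_n) u v : M^T = M -> dotv u (M *m v) = dotv v (M *m u).
Proof. by move=> Ms; rewrite dotv_mulmx Ms dotvC. Qed.

Lemma sqr_le_of_nonneg_quadratic (a b c : R) :
  (forall t, 0 <= a * t ^+ 2 + 2 * b * t + c) -> b ^+ 2 <= a * c.
Proof.
move=> h; have [a0|a0] := eqVneq a 0.
  have [->|b0] := eqVneq b 0; first by rewrite a0; lra.
  have := h (- (c + 1) / (2 * b)); rewrite a0.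
  have -> : 0 * (- (c + 1) / (2 * b)) ^+ 2 + 2 * b * (- (c + 1) / (2 * b)) + c
     = -1 by field.
  by lra.
have ap : 0 < a.
  rewrite lt_def a0 /= leNgt; apply/negP => an.
  have := h ((`|b| + `|c| + 1 - a)/ - a).
  set t := (_ / _); have ta : t * a = - (`|b| + `|c| + 1 - a) by rewrite /t; field.
  have t1 : 1 <= t by rewrite /t ler_pdivlMr ?oppr_gt0//; have := normr_ge0 b; have := normr_ge0 c; lra.
  have bb := ler_norm b; have cc := ler_norm c.
  have nb := normr_ge0 b; have nc := normr_ge0 c.
  have c1 : `|c| <= `|c| * t by rewrite ler_peMr.
  have := h (2 * t).
  have b1 : b * t <= `|b| * t by rewrite ler_pM2r//; lra.
  have -> : a * (2 * t) ^+ 2 = 4 * (t * a) * t by ring.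
  rewrite ta; nra.
have := h (- b / a).
have -> : a * (- b / a) ^+ 2 + 2 * b * (- b / a) + c = (a * c - b ^+ 2) / a by field.
by rewrite pmulr_lge0 ?invr_gt0// subr_ge0.
Qed.

Lemma cauchy_schwarz_psd n (M : 'M[R]_n) u v : M^T = M ->
  (forall w, 0 <= dotv w (M *m w)) ->
  dotv u (M *m v) ^+ 2 <= dotv u (M *m u) * dotv v (M *m v).
Proof.
move=> Ms M0; rewrite mulrC; apply: sqr_le_of_nonneg_quadratic => t.
have := M0 (u + t *: v).
rewrite mulmxDr -scalemxAr !(dotvDl, dotvDr, dotvZl, dotvZr) (dotv_sym _ _ v u)//.
by congr (_ <= _); ring.
Qed.

Lemma cauchy_schwarz n (u v : 'cV[R]_n) : `|dotv u v| <= enorm u * enorm v.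
Proof.
rewrite -(@ler_pXn2r _ 2)// ?nnegrE ?mulr_ge0 ?enorm_ge0//.
rewrite exprMn !enorm_sqr real_normK ?num_real//.
have := @cauchy_schwarz_psd n 1%:M u v; rewrite !mul1mx; apply.
  by rewrite tr_scalar_mx.
by move=> w; rewrite mul1mx dotv_ge0.
Qed.

Lemma enormD n (u v : 'cV[R]_n) : enorm (u + v) <= enorm u + enorm v.
Proof.
apply: enorm_le; first by rewrite addr_ge0 ?enorm_ge0.
rewrite !(dotvDl, dotvDr) (dotvC v u) -!enorm_sqr.
by have := cauchy_schwarz _ u v; rewrite ler_norml => /andP[_]; lra.
Qed.

Lemma enorm_le_sum n (v : 'cV[R]_n) : enorm v <= \sum_i `|v i 0|.
Proof.
apply: enorm_le; first by rewrite sumr_ge0.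
rewrite dotvE expr2 mulr_suml ler_sum// => i _.
rewrite (le_trans (ler_norm _))// normrM ler_wpM2l// (bigD1 i)//= lerDl.
by rewrite sumr_ge0.
Qed.

Lemma enorm_mulmx_le m n (M : 'M[R]_(m, n)) v :
  enorm (M *m v) <= (\sum_i \sum_j `|M i j|) * enorm v.
Proof.
apply: (le_trans (enorm_le_sum _ _)); rewrite mulr_suml ler_sum// => i _.
rewrite mxE mulr_suml (le_trans (ler_norm_sum _ _ _))// ler_sum// => j _.
by rewrite normrM ler_wpM2l// normr_coord_le_enorm.
Qed.

Lemma enorm_mulmx_le_const m n (M : 'M[R]_(m, n)) c v :
  (forall i j, `|M i j| <= c) -> enorm (M *m v) <= c *+ n *+ m * enorm v.
Proof.
move=> Mc; apply: (le_trans (enorm_mulmx_le _ _ _ _)).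
rewrite ler_wpM2r ?enorm_ge0//.
rewrite (_ : c *+ n *+ m = \sum_(i < m) \sum_(j < n) c).
  by do 2!apply: ler_sum => ? _.
by rewrite !sumr_const !card_ord.
Qed.

Lemma dotv_mulmx_le n (M : 'M[R]_n) c u v :
  (forall w, enorm (M *m w) <= c * enorm w) ->
  `|dotv u (M *m v)| <= c * (enorm u * enorm v).
Proof.
move=> Mc; apply: (le_trans (cauchy_schwarz _ _ _)).
by rewrite mulrCA ler_wpM2l ?enorm_ge0.
Qed.

(** The infimum of the Rayleigh quotient of a symmetric matrix [M] is an
eigenvalue.  No compactness is needed: with [mu] the infimum, [M - mu] is
positive semidefinite, and were it invertible, the Cauchy-Schwarz inequality
for its quadratic form would bound that form away from zero on unit vectors,
so that [mu] could be increased. *)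
Lemma eigenvalue_rayleigh_inf n (M : 'M[R]_n.+1) : M^T = M ->
  exists mu, eigenvalue M mu /\ forall v, mu * dotv v v <= dotv v (M *m v).
Proof.
move=> Ms; pose S := [set dotv v (M *m v) | v in [set v : 'cV[R]_n.+1 | dotv v v = 1]]%classic.
have [C [C0 MC]] : exists C : R, 0 <= C /\ forall v, enorm (M *m v) <= C * enorm v.
  exists (\sum_i \sum_j `|M i j|); split; last by move=> v; exact: enorm_mulmx_le.
  by rewrite sumr_ge0// => i _; rewrite sumr_ge0.
have enorm1 v : dotv v v = 1 -> enorm v = 1 :> R by rewrite /enorm => ->; rewrite sqrtr1.
have S0 : (S !=set0)%classic.
  exists (dotv (delta_mx 0 0) (M *m delta_mx 0 0)); exists (delta_mx 0 0) => //=.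
  by rewrite dotvE (bigD1 0)//= big1 ?mxE ?eqxx/= ?mulr1 ?addr0// => i i0; rewrite mxE (negbTE i0) mul0r.
have lbS : has_lbound S.
  exists (- C) => _ [v /= v1 <-].
  have := dotv_mulmx_le _ M C v v MC; rewrite enorm1// !mulr1.
  by rewrite ler_norml => /andP[].
have iS : has_inf S by split.
pose mu := inf S; exists mu.
have mule v : mu * dotv v v <= dotv v (M *m v).
  have [->|v0] := eqVneq v 0; first by rewrite mulmx0 !dotvE !big1 ?mulr0// => i _; rewrite mxE mul0r.
  have vn := enorm_gt0 _ v0.
  have : mu <= dotv ((enorm v)^-1 *: v) (M *m ((enorm v)^-1 *: v)).
    by apply: ge_inf => //; exists ((enorm v)^-1 *: v) => //=; rewrite enorm_unit.
  rewrite -scalemxAr dotvZl dotvZr -enorm_sqr mulrA -invfM -expr2 mulrC.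
  by rewrite ler_pdivlMr// exprn_gt0.
split=> //; rewrite /eigenvalue /eigenspace kermx_eq0 row_free_unit.
apply/negP; set P := (M - _) => Pu.
have Ps : P^T = P by rewrite /P linearB /= Ms tr_scalar_mx.
have PE v : dotv v (P *m v) = dotv v (M *m v) - mu * dotv v v.
  by rewrite /P mulmxBl mul_scalar_mx dotvDr dotvNr dotvZr.
have P0 v : 0 <= dotv v (P *m v) by rewrite PE subr_ge0.
have [D [D0 PD]] : exists D : R, 0 < D /\ forall v, enorm (P *m v) <= D * enorm v.
  exists (1 + \sum_i \sum_j `|P i j|); split.
    by rewrite ltr_wpDr// sumr_ge0// => i _; rewrite sumr_ge0.
  move=> v; apply: (le_trans (enorm_mulmx_le _ _ _ _)).
  by rewrite ler_wpM2r ?enorm_ge0// lerDr.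
have [K [K0 PK]] : exists K : R, 0 < K /\ forall v, enorm v <= K * enorm (P *m v).
  exists (1 + \sum_i \sum_j `|invmx P i j|); split.
    by rewrite ltr_wpDr// sumr_ge0// => i _; rewrite sumr_ge0.
  move=> v; rewrite -{1}(mulKmx Pu v); apply: (le_trans (enorm_mulmx_le _ _ _ _)).
  by rewrite ler_wpM2r ?enorm_ge0// lerDr.
have e0 : 0 < (K ^+ 2 * D)^-1 by rewrite invr_gt0 mulr_gt0// exprn_gt0.
have [_ [v /= v1 <-]] := inf_adherent e0 iS.
apply/negP; rewrite -leNgt -/mu -lerBrDl.
rewrite (_ : _ - mu = dotv v (P *m v)); last by rewrite PE v1 mulr1.
rewrite -div1r ler_pdivrMr ?mulr_gt0 ?exprn_gt0//.
have Kv := PK v; rewrite enorm1// in Kv.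
have Pv0 : 0 < enorm (P *m v) by rewrite -(pmulr_rgt0 _ K0); lra.
have key : enorm (P *m v) ^+ 2 <= D * dotv v (P *m v).
  have := @cauchy_schwarz_psd _ P (P *m v) v Ps P0.
  rewrite -enorm_sqr => cs.
  have le1 : dotv (P *m v) (P *m (P *m v)) <= D * enorm (P *m v) ^+ 2.
    have := dotv_mulmx_le _ P D (P *m v) (P *m v) PD.
    by rewrite -expr2 ler_norml => /andP[].
  rewrite -(@ler_pM2l _ (enorm (P *m v) ^+ 2)) ?exprn_gt0//.
  rewrite -expr2 (le_trans cs)// mulrA (mulrC _ D) ler_wpM2r//.
have : 1 <= K ^+ 2 * enorm (P *m v) ^+ 2.
  by rewrite -exprMn exprn_ege1.
move=> /le_trans; apply.
by rewrite [leRHS]mulrC -[leRHS]mulrA ler_pM2l ?exprn_gt0.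
Qed.

Lemma posdef_lower_bound n (M : 'M[R]_n.+1) : posdef M ->
  exists g, 0 < g /\ forall v, g * dotv v v <= dotv v (M *m v).
Proof.
move=> [Ms Mp]; have [g [/eigenvalueP[v vM v0] gM]] := eigenvalue_rayleigh_inf _ M Ms.
exists g; split => //.
have vT0 : v^T != 0 by rewrite -[0]trmx0 (inj_eq trmx_inj).
have := Mp _ vT0; rewrite -[X in dotv _ (X *m _)]Ms -trmx_mul vM linearZ /= dotvZr.
by rewrite pmulr_lgt0// dotv_gt0.
Qed.

Lemma lambda_min_le n (M : 'M[R]_n.+1) v : posdef M ->
  lambda_min M * dotv v v <= dotv v (M *m v).
Proof.
move=> [Ms Mp]; have [g [ge gM]] := eigenvalue_rayleigh_inf _ M Ms.
apply: le_trans (gM v); rewrite ler_wpM2r ?dotv_ge0//.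
apply: ge_inf => //; exists 0 => a /eigenvalueP[w wM w0].
have wT0 : w^T != 0 by rewrite -[0]trmx0 (inj_eq trmx_inj).
have := Mp _ wT0; rewrite -[X in dotv _ (X *m _)]Ms -trmx_mul wM linearZ /= dotvZr.
by rewrite pmulr_lgt0 ?dotv_gt0// => /ltW.
Qed.

Lemma enorm_mulmx_le_opnorm m n (M : 'M[R]_(m, n)) v :
  enorm (M *m v) <= opnorm M * enorm v.
Proof.
have [->|v0] := eqVneq v 0; first by rewrite mulmx0 !enorm0 mulr0.
have vn := enorm_gt0 _ v0.
rewrite -ler_pdivrMr// mulrC.
rewrite -[leLHS](_ : enorm (M *m ((enorm v)^-1 *: v)) = _); last first.
  by rewrite -scalemxAr enormZ ger0_norm// invr_ge0 ltW.
apply: sup_ubound; last first.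
  exists ((enorm v)^-1 *: v) => //=.
  rewrite enormZ ger0_norm; last by rewrite invr_ge0 ltW.
  by rewrite mulVf// gt_eqF.
exists (\sum_i \sum_j `|M i j|) => _ [w /= w1 <-].
apply: (le_trans (enorm_mulmx_le _ _ _ _)); rewrite ler_piMr//.
by rewrite sumr_ge0// => i _; rewrite sumr_ge0.
Qed.

Lemma posdef_unitmx n (M : 'M[R]_n) : posdef M -> M \in unitmx.
Proof.
move=> [Ms Mp]; rewrite -row_free_unit -kermx_eq0; apply/eqP/row_matrixP => i.
rewrite row0; apply/eqP/negPn/negP => k0.
have kT0 : (row i (kermx M))^T != 0 by rewrite -[0]trmx0 (inj_eq trmx_inj).
have := Mp _ kT0; rewrite -[X in dotv _ (X *m _)]Ms -trmx_mul -row_mul mulmx_ker row0 trmx0.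
by rewrite dotvE big1 ?ltxx// => j _; rewrite [X in _ * X]mxE mulr0.
Qed.

End EuclideanGeometry.

(** * Algebras of functions and matrices over them *)

Section FunctionAlgebras.
Context {R : realType} {A : Type}.

(** Trigonometric polynomials, continuous functions and the vector field
coordinates suitable for Picard iteration are all closed under sums and
products; the closure of matrices over them under the matrix operations is
then proved once. *)
Record function_algebra (C : (A -> R) -> Prop) : Prop := FunctionAlgebra {
  fun_alg_cst : forall c, C (fun=> c);
  fun_algD : forall f g, C f -> C g -> C (fun a => f a + g a);
  fun_algM : forall f g, C f -> C g -> C (fun a => f a * g a)
}.

Definition entrywise (C : (A -> R) -> Prop) m n (M : A -> 'M[R]_(m, n)) :=
  forall i j, C (fun a => M a i j).

Variable C : (A -> R) -> Prop.
Hypothesis HC : function_algebra C.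

Lemma eq_fun_alg f g : f =1 g -> C f -> C g.
Proof. by move=> /funext ->. Qed.

Lemma fun_algN f : C f -> C (fun a => - f a).
Proof.
move=> Cf; apply: eq_fun_alg (fun_algM _ HC _ _ (fun_alg_cst _ HC (-1)) Cf) => a.
by rewrite mulN1r.
Qed.

Lemma fun_alg_sum n (F : 'I_n -> A -> R) :
  (forall i, C (F i)) -> C (fun a => \sum_i F i a).
Proof.
elim: n F => [|n ih] F CF.
  by apply: eq_fun_alg (fun_alg_cst _ HC 0) => a; rewrite big_ord0.
apply: eq_fun_alg (fun_algD _ HC _ _ (CF ord0) (ih _ (fun i => CF (lift ord0 i)))) => a.
by rewrite big_ord_recl.
Qed.

Lemma entrywise_cst m n (M : 'M[R]_(m, n)) : entrywise C m n (fun=> M).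
Proof. by move=> i j; exact: fun_alg_cst. Qed.

Lemma entrywiseD m n (M N : A -> 'M[R]_(m, n)) : entrywise C m n M ->
  entrywise C m n N -> entrywise C m n (fun a => M a + N a).
Proof.
by move=> hM hN i j; apply: eq_fun_alg (fun_algD _ HC _ _ (hM i j) (hN i j)) => a; rewrite mxE.
Qed.

Lemma entrywiseN m n (M : A -> 'M[R]_(m, n)) : entrywise C m n M ->
  entrywise C m n (fun a => - M a).
Proof. by move=> hM i j; apply: eq_fun_alg (fun_algN _ (hM i j)) => a; rewrite mxE. Qed.

Lemma entrywiseZ m n (f : A -> R) (M : A -> 'M[R]_(m, n)) : C f ->
  entrywise C m n M -> entrywise C m n (fun a => f a *: M a).
Proof.
by move=> hf hM i j; apply: eq_fun_alg (fun_algM _ HC _ _ hf (hM i j)) => a; rewrite mxE.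
Qed.

Lemma entrywise_tr m n (M : A -> 'M[R]_(m, n)) : entrywise C m n M ->
  entrywise C n m (fun a => (M a)^T).
Proof. by move=> hM i j; apply: eq_fun_alg (hM j i) => a; rewrite mxE. Qed.

Lemma entrywiseM m n p (M : A -> 'M[R]_(m, n)) (N : A -> 'M[R]_(n, p)) :
  entrywise C m n M -> entrywise C n p N -> entrywise C m p (fun a => M a *m N a).
Proof.
move=> hM hN i j.
apply: eq_fun_alg (fun_alg_sum _ _ (fun k => fun_algM _ HC _ _ (hM i k) (hN k j))) => a.
by rewrite mxE.
Qed.

Lemma entrywise_scalar n (f : A -> R) : C f -> entrywise C n n (fun a => (f a)%:M).
Proof.
move=> hf i j; apply: eq_fun_alg (fun_algM _ HC _ _ hf (fun_alg_cst _ HC (i == j)%:R)) => a.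
by rewrite mxE mulr_natr.
Qed.

Lemma entrywise_usub m n p (M : A -> 'M[R]_(m + n, p)) : entrywise C _ _ M ->
  entrywise C m p (fun a => usubmx (M a)).
Proof. by move=> hM i j; apply: eq_fun_alg (hM (lshift n i) j) => a; rewrite mxE. Qed.

Lemma entrywise_dsub m n p (M : A -> 'M[R]_(m + n, p)) : entrywise C _ _ M ->
  entrywise C n p (fun a => dsubmx (M a)).
Proof. by move=> hM i j; apply: eq_fun_alg (hM (rshift m i) j) => a; rewrite mxE. Qed.

Lemma entrywise_col_mx m n p (M : A -> 'M[R]_(m, p)) (N : A -> 'M[R]_(n, p)) :
  entrywise C _ _ M -> entrywise C _ _ N ->
  entrywise C _ _ (fun a => col_mx (M a) (N a)).
Proof.
move=> hM hN i j; case: (split_ordP i) => k ->.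
  by apply: eq_fun_alg (hM k j) => a; rewrite col_mxEu.
by apply: eq_fun_alg (hN k j) => a; rewrite col_mxEd.
Qed.

Lemma fun_alg_dotv n (u v : A -> 'cV[R]_n) : entrywise C _ _ u ->
  entrywise C _ _ v -> C (fun a => dotv (u a) (v a)).
Proof. by move=> hu hv; apply: entrywiseM => //; exact: entrywise_tr. Qed.

Lemma entrywise_vec3 (a b c : A -> R) : C a -> C b -> C c ->
  entrywise C _ _ (fun t => vec3 (a t) (b t) (c t)).
Proof.
move=> ha hb hc [[|[|[|]]] // ?] j;
  [apply: eq_fun_alg ha|apply: eq_fun_alg hb|apply: eq_fun_alg hc] => t;
  by rewrite mxE.
Qed.

Lemma entrywise_crossmx (v : A -> 'cV[R]_3) : entrywise C _ _ v ->
  entrywise C _ _ (fun a => crossmx (v a)).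
Proof.
move=> hv i j.
have t0 := fun_alg_cst _ HC 0.
have tv k : C (fun a => v a (inord k) 0) by exact: hv.
have tN k : C (fun a => - v a (inord k) 0) by exact/fun_algN/hv.
case: i => [[|[|[|]]]]// ?; case: j => [[|[|[|]]]]// ?;
  apply: eq_fun_alg => [a|]; rewrite ?/crossmx ?mxE //=; (exact: t0 || exact: tv || exact: tN).
Qed.

End FunctionAlgebras.

(** * Cross products *)

Section CrossProduct.
Context {R : realType}.
Implicit Types a b : 'cV[R]_3.

Lemma sum_ord3 (F : 'I_3 -> R) : \sum_i F i = F (inord 0) + F (inord 1) + F (inord 2).
Proof.
rewrite !big_ord_recr big_ord0 /= add0r.
by congr (F _ + F _ + F _); apply/val_inj; rewrite /= inordK.
Qed.

Lemma crossmx_mulE a b : crossmx a *m b = vec3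
  (a (inord 1) 0 * b (inord 2) 0 - a (inord 2) 0 * b (inord 1) 0)
  (a (inord 2) 0 * b (inord 0) 0 - a (inord 0) 0 * b (inord 2) 0)
  (a (inord 0) 0 * b (inord 1) 0 - a (inord 1) 0 * b (inord 0) 0).
Proof.
apply/matrixP => i j; have -> : j = 0 by exact: ord1.
rewrite mxE sum_ord3 !mxE !inordK//.
by case: i => [[|[|[|]]]]// ?; rewrite /=; ring.
Qed.

(** This is Lagrange's identity
[|a x b|^2 = |a|^2 |b|^2 - (a . b)^2]. *)
Lemma enorm_crossmx_le a b : enorm (crossmx a *m b) <= enorm a * enorm b.
Proof.
apply: enorm_le; first by rewrite mulr_ge0 ?enorm_ge0.
rewrite exprMn !enorm_sqr crossmx_mulE !dotvE !sum_ord3 !mxE !inordK//=.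
move: (a (inord 0) 0) (a (inord 1) 0) (a (inord 2) 0) => a1 a2 a3.
move: (b (inord 0) 0) (b (inord 1) 0) (b (inord 2) 0) => b1 b2 b3.
rewrite -subr_ge0; have := sqr_ge0 (a1 * b1 + a2 * b2 + a3 * b3).
by congr (_ <= _); ring.
Qed.

Lemma tr_crossmx a : (crossmx a)^T = - crossmx a.
Proof.
apply/matrixP => i j; rewrite !mxE.
by case: i => [[|[|[|]]]]// ?; case: j => [[|[|[|]]]]// ?; rewrite /= ?oppr0 ?opprK.
Qed.

Lemma dotv_crossmx_self a b : dotv a (crossmx a *m b) = 0.
Proof. by rewrite crossmx_mulE dotvE sum_ord3 !mxE !inordK//=; ring. Qed.

Lemma dotv_col_mx m n (a c : 'cV[R]_m) (b d : 'cV[R]_n) :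
  dotv (col_mx a b) (col_mx c d) = dotv a c + dotv b d.
Proof. by rewrite /dotv tr_col_mx mul_row_col mxE. Qed.

End CrossProduct.

(** * Real calculus *)

Section RealCalculus.
Local Open Scope classical_set_scope.
Local Open Scope ring_scope.
Context {R : realType}.
Implicit Types (f g F : R -> R) (t : R).

Lemma normr_maxB_le (a r s : R) : `|Num.max a r - Num.max a s| <= `|r - s|.
Proof.
have := ler_norm (s - r); have := ler_norm (r - s); rewrite ler_norml (distrC s).
move: `|r - s| => d h1 h2.
by case: (leP a r) => ?; case: (leP a s) => ?; apply/andP; split; lra.
Qed.

Lemma normr_minB_le (a r s : R) : `|Num.min a r - Num.min a s| <= `|r - s|.
Proof.
have := ler_norm (s - r); have := ler_norm (r - s); rewrite ler_norml (distrC s).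
move: `|r - s| => d h1 h2.
by case: (leP a r) => ?; case: (leP a s) => ?; apply/andP; split; lra.
Qed.

Lemma is_derive1D f g t (df dg : R) : is_derive t 1 f df -> is_derive t 1 g dg ->
  is_derive t 1 (fun s => f s + g s) (df + dg).
Proof. exact: is_deriveD. Qed.

Lemma is_derive1M f g t (df dg : R) : is_derive t 1 f df -> is_derive t 1 g dg ->
  is_derive t 1 (fun s => f s * g s) (df * g t + f t * dg).
Proof.
move=> hf hg; apply: (is_derive_eq (is_deriveM hf hg)).
by rewrite addrC mulrC.
Qed.

Lemma is_derive1Z a f t (df : R) : is_derive t 1 f df ->
  is_derive t 1 (fun s => a * f s) (a * df).
Proof. exact: is_deriveZ. Qed.

Lemma is_derive1_affine a b t : is_derive t 1 (fun s : R => a * s + b) a.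
Proof.
apply: (is_derive_eq (is_derive1D _ _ _ _ _ (is_derive1Z a _ _ _ (is_derive_id t 1)) (is_derive_cst b t 1))).
by rewrite mulr1 addr0.
Qed.

Lemma is_derive_continuous f t (df : R) : is_derive t 1 f df ->
  {for t, continuous f}.
Proof.
by move=> [hf _]; apply: differentiable_continuous; exact/derivable1_diffP.
Qed.

Lemma is_derive_within_continuous f df (D : set R) :
  (forall t, D t -> is_derive t 1 f (df t)) -> {within D, continuous f}.
Proof.
move=> hf; apply: continuous_in_subspaceT => t /set_mem Dt.
exact: is_derive_continuous (hf t Dt).
Qed.

Lemma antiderivative_exists f (a : R) : continuous f ->
  exists F, forall t, a < t -> is_derive t 1 F (f t).
Proof.
move=> cf; exists (fun x => (\int[lebesgue_measure]_(s in `[a, x]) f s)%R) => t at_.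
have tt : t < t + 1 by rewrite ltrDl.
have fint : lebesgue_measure.-integrable `[a, t + 1] (EFin \o f).
  apply: continuous_compact_integrable; first exact: segment_compact.
  exact: continuous_subspaceT.
have [h1 h2] := continuous_FTC1_closed tt fint at_ (cf t).
by rewrite derive1E in h2; exact: (DeriveDef h1 h2).
Qed.

(** The fundamental theorem of calculus turns a bounded primitive of [f - c]
into convergence of the time averages of [f] to [c], at rate [1 / T]. *)
Lemma average_cvg f F (c B : R) : continuous f ->
  (forall t, `|F t| <= B) -> (forall t, is_derive t 1 F (f t - c)) ->
  ((T^-1 * \int[lebesgue_measure]_(s in `[0%R, T]) f s) @[T --> +oo] --> c)%classic.
Proof.
move=> cf FB dF; apply/cvgrPdist_le => e e0.
have intE (T : R) : 0 < T ->
    \int[lebesgue_measure]_(s in `[0%R, T]) f s = F T + c * T - F 0.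
  move=> T0; pose H s := F s + (c * s + 0).
  have dH (s : R) : is_derive s 1 H (f s).
    apply: (is_derive_eq (is_derive1D _ _ _ _ _ (dF s) (is_derive1_affine c 0 s))).
    by rewrite subrK.
  have cH : continuous H by move=> s; exact: is_derive_continuous (dH s).
  rewrite /Rintegral (continuous_FTC2 T0 _ (F := H)).
  - by rewrite -EFinB /= /H mulr0 !addr0.
  - exact: continuous_subspaceT.
  - split; first by move=> s _; case: (dH s).
    + exact/cvg_at_right_filter/cH.
    + exact/cvg_at_left_filter/cH.
  - by move=> s _; rewrite derive1E; exact: derive_val.
near=> T.
have T0 : 0 < T by near: T; exact: nbhs_pinfty_gt.
have Te : 2 * B / e <= T by near: T; apply: nbhs_pinfty_ge; rewrite num_real.
rewrite intE// (_ : c - _ = (F 0 - F T) / T); last by field; rewrite gt_eqF.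
rewrite normrM normfV (gtr0_norm T0) ler_pdivrMr//.
apply: (le_trans (ler_normB _ _)).
move: Te; rewrite ler_pdivrMr//; have := FB 0; have := FB T; rewrite (mulrC T); lra.
Unshelve. all: by end_near. Qed.

End RealCalculus.

(** * Trigonometric polynomials *)

Section TrigonometricPolynomials.
Context {R : realType}.
Implicit Types f g : R -> R.

(** Phases absorb sines and frequency zero gives the constants, so cosines
suffice as generators. *)
Inductive trigpoly : (R -> R) -> Prop :=
| trigpoly_cos a nu phi : trigpoly (fun t => a * cos (nu * t + phi))
| trigpolyD f g : trigpoly f -> trigpoly g -> trigpoly (fun t => f t + g t).

Lemma trigpoly_cst c : trigpoly (fun=> c).
Proof.
by apply: (eq_fun_alg _ _ _ _ (trigpoly_cos c 0 0)) => t; rewrite mul0r addr0 cos0 mulr1.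
Qed.

Lemma trigpoly_sin a nu phi : trigpoly (fun t => a * sin (nu * t + phi)).
Proof.
apply: (eq_fun_alg _ _ _ _ (trigpoly_cos a nu (phi - pi / 2))) => t.
by rewrite addrA cosBpihalf.
Qed.

Lemma trigpolyM f g : trigpoly f -> trigpoly g -> trigpoly (fun t => f t * g t).
Proof.
elim=> [a nu phi|f1 f2 _ h1 _ h2] tg; last first.
  by apply: (eq_fun_alg _ _ _ _ (trigpolyD _ _ (h1 tg) (h2 tg))) => t; rewrite mulrDl.
elim: tg => [b mu psi|g1 g2 _ h1 _ h2]; last first.
  by apply: (eq_fun_alg _ _ _ _ (trigpolyD _ _ h1 h2)) => t; rewrite mulrDr.
apply: (eq_fun_alg _ _ _ _ (trigpolyD _ _
  (trigpoly_cos (a * b / 2) (nu - mu) (phi - psi))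
  (trigpoly_cos (a * b / 2) (nu + mu) (phi + psi)))) => t.
have -> : (nu - mu) * t + (phi - psi) = (nu * t + phi) - (mu * t + psi) by ring.
have -> : (nu + mu) * t + (phi + psi) = (nu * t + phi) + (mu * t + psi) by ring.
by move: (nu * t + phi) (mu * t + psi) => x y; rewrite cosB cosD; field.
Qed.

Lemma trigpoly_algebra : function_algebra trigpoly.
Proof. by split; [exact: trigpoly_cst|exact: trigpolyD|exact: trigpolyM]. Qed.

Lemma normr_cos_le1 (x : R) : `|cos x| <= 1.
Proof. by rewrite ler_norml cos_geN1 cos_le1. Qed.

Lemma normr_sin_le1 (x : R) : `|sin x| <= 1.
Proof. by rewrite ler_norml sin_geN1 sin_le1. Qed.

Lemma trigpoly_bounded f : trigpoly f -> exists B, forall t, `|f t| <= B.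
Proof.
elim=> [a nu phi|{}f g _ [B fB] _ [C gC]].
  by exists `|a| => t; rewrite normrM ler_piMr// normr_cos_le1.
by exists (B + C) => t; rewrite (le_trans (ler_normD _ _))// lerD.
Qed.

Lemma trigpoly_continuous f : trigpoly f -> continuous f.
Proof.
elim=> [a nu phi|{}f g _ cf _ cg] t; last exact: (continuousD (cf t) (cg t)).
exact: (is_derive_continuous _ _ _ (is_derive1Z a _ _ _
  (is_derive1_comp (is_derive_cos _) (is_derive1_affine nu phi t)))).
Qed.

(** A cosine of nonzero frequency [nu] has the bounded primitive
[sin (nu * t + phi) / nu]; the terms of frequency zero make up the constant.
Resonances between the factors of a product are thus harmless: they only
contribute to the average. *)
Lemma trigpoly_primitive f : trigpoly f ->
  exists (c : R) (F : R -> R), (exists B, forall t, `|F t| <= B) /\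
    forall t : R, is_derive t 1 F (f t - c).
Proof.
elim=> [a nu phi|{}f g _ [c [F [[B FB] dF]]] _ [d [G [[C GC] dG]]]]; last first.
  exists (c + d), (fun t => F t + G t); split.
    by exists (B + C) => t; rewrite (le_trans (ler_normD _ _))// lerD.
  move=> t; apply: (is_derive_eq (is_derive1D _ _ _ _ _ (dF t) (dG t))).
  by rewrite opprD addrACA.
have [->|nu0] := eqVneq nu 0.
  exists (a * cos phi), (fun=> 0); split; first by exists 0 => t; rewrite normr0.
  by move=> t; apply: (is_derive_eq (is_derive_cst 0 t 1)); rewrite mul0r add0r subrr.
exists 0, (fun t => (a / nu) * sin (nu * t + phi)); split.
  by exists `|a / nu| => t; rewrite normrM ler_piMr// normr_sin_le1.
move=> t; apply: (is_derive_eq (is_derive1Z (a / nu) _ _ _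
  (is_derive1_comp (is_derive_sin _) (is_derive1_affine nu phi t)))).
by rewrite /=; field.
Qed.

End TrigonometricPolynomials.

(** * The geomagnetic matrix and its average *)

Section Geomagnetism.
Context {R : realType}.
Variable p : dipole_orbit R.

(** The orbit is circular, so the normalization of the position and the power
of its norm in the field strength are constants; this is what makes the field
a trigonometric polynomial. *)
Lemma enorm_orb_position t : enorm (orb_position p t) = enorm (orb_position p 0).
Proof.
suff E s : dotv (orb_position p s) (orb_position p s) = orb_radius p ^+ 2.
  by rewrite /enorm !E.
rewrite /orb_position; set A := Rz _ *m Rx _; set v := vec3 _ _ _.
have RzR a : (@Rz R a)^T *m Rz a = 1%:M.
  apply/matrixP => i j; rewrite !mxE !big_ord_recr big_ord0 /= !mxE /=.
  have := cos2Dsin2 a; rewrite !expr2 => cs.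
  case: i => [[|[|[|]]]]// ?; case: j => [[|[|[|]]]]// ?; rewrite /=; (ring || (rewrite -cs; ring)).
have RxR a : (@Rx R a)^T *m Rx a = 1%:M.
  apply/matrixP => i j; rewrite !mxE !big_ord_recr big_ord0 /= !mxE /=.
  have := cos2Dsin2 a; rewrite !expr2 => cs.
  case: i => [[|[|[|]]]]// ?; case: j => [[|[|[|]]]]// ?; rewrite /=; (ring || (rewrite -cs; ring)).
have AA : A^T *m A = 1%:M.
  by rewrite /A trmx_mul -mulmxA (mulmxA (Rz _)^T) RzR mul1mx RxR.
rewrite dotv_mulmx mulmxA AA mul1mx.
rewrite dotvE !big_ord_recr big_ord0 /= /v !mxE /=.
set x := _ * s + _; rewrite -[X in _ = X]mulr1 -(cos2Dsin2 x).
by ring.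
Qed.

Lemma Gamma_trigpoly : entrywise trigpoly _ _ (Gamma p).
Proof.
have alg := @trigpoly_algebra R.
have tpos : entrywise trigpoly _ _ (orb_position p).
  apply: entrywiseM => //; first exact: entrywise_cst.
  by apply: entrywise_vec3; [exact: trigpoly_cos|exact: trigpoly_sin|exact: trigpoly_cst].
have tdir : entrywise trigpoly _ _ (orb_direction p).
  apply: entrywiseZ => //; apply: eq_fun_alg (trigpoly_cst (enorm (orb_position p 0))^-1) => t.
  by rewrite [in RHS]enorm_orb_position.
have tdip : entrywise trigpoly _ _ (dip_direction p).
  by apply: entrywise_vec3; [exact: trigpoly_cos|exact: trigpoly_sin|exact: trigpoly_cst].
have tB : entrywise trigpoly _ _ (geofield p).
  apply: entrywiseZ => //.
    apply: eq_fun_alg (trigpoly_cst (dip_strength p / enorm (orb_position p 0) ^+ 3)) => t.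
    by rewrite [in RHS]enorm_orb_position.
  apply: entrywiseD => //; last exact: entrywiseN.
  apply: entrywiseZ => //; apply: trigpolyM; first exact: trigpoly_cst.
  exact: fun_alg_dotv.
by apply: entrywiseM => //; [|apply: entrywise_tr]; exact: entrywise_crossmx.
Qed.

Lemma Gamma_bounded : exists c, forall t i j, `|Gamma p t i j| <= c.
Proof.
have B i j := cid (trigpoly_bounded _ (Gamma_trigpoly i j)).
exists (\sum_i \sum_j sval (B i j)) => t i j.
have B0 k l : 0 <= sval (B k l) by apply: le_trans (svalP (B k l) 0).
apply: (le_trans (svalP (B i j) t)).
rewrite (bigD1 i)//= (bigD1 j)//= -addrA lerDl addr_ge0// sumr_ge0// => k _.
by rewrite sumr_ge0.
Qed.

(** Besides positive definiteness, this is the only property of the average that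
the stability analysis uses: boundedness of the primitive, and not just its
sublinear growth, lets it enter the Lyapunov function as a correction of
relative size [eps]. *)
Lemma Gamma_oscillation_primitive : exists Delta : R -> 'M[R]_3,
  (exists c, forall t i j, `|Delta t i j| <= c) /\
  forall (t : R) i j, is_derive t 1 (fun s => Delta s i j) (Gamma p t i j - Gamma_av p i j).
Proof.
have H i j : exists F : R -> R, (exists B, forall t, `|F t| <= B) /\
    forall t : R, is_derive t 1 F (Gamma p t i j - Gamma_av p i j).
  have tG := Gamma_trigpoly i j.
  have [c [F [[B FB] dF]]] := trigpoly_primitive _ tG.
  have E : Gamma_av p i j = c.
    rewrite mxE; apply: cvg_lim; first exact: Rhausdorff.
    exact: average_cvg (trigpoly_continuous _ tG) FB dF.
  by exists F; split; [exists B|move=> t; rewrite E].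
pose F i j := sval (cid (H i j)).
exists (fun t => \matrix_(i, j) F i j t); split.
  have B i j := cid (svalP (cid (H i j))).1.
  exists (\sum_i \sum_j sval (B i j)) => t i j.
  have B0 k l : 0 <= sval (B k l) by apply: le_trans (svalP (B k l) 0).
  rewrite mxE; apply: (le_trans (svalP (B i j) t)).
  rewrite (bigD1 i)//= (bigD1 j)//= -addrA lerDl addr_ge0// sumr_ge0// => k _.
  by rewrite sumr_ge0.
move=> t i j; have := (svalP (cid (H i j))).2 t; rewrite -/(F i j).
by congr is_derive; apply/funext => s; rewrite mxE.
Qed.

End Geomagnetism.

(** * Comparison principles *)

Section ComparisonPrinciples.
Local Open Scope classical_set_scope.
Local Open Scope ring_scope.
Context {R : realType}.

Lemma nonincreasing_endpoints (H : R -> R) (a b : R) : a <= b ->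
  {within `[a, b], continuous H} ->
  (forall t : R, a < t < b -> exists d : R, is_derive t 1 H d /\ d <= 0) ->
  H b <= H a.
Proof.
move=> ab cH dH.
have d1 t : t \in `]a, b[ -> derivable H t 1.
  by rewrite in_itv /= => /dH[d [[]]].
have d2 t : t \in `]a, b[ -> (H^`() t <= 0)%classic.
  by rewrite in_itv /= derive1E => /dH[d [[_ ->]]].
by apply: (ler0_derive1_le_cc d1 d2 cH); rewrite ?in_itv /= ?lexx ?ab.
Qed.

(** Applied to an integral and to an explicit primitive of a bound of the
integrand, this replaces the estimation of integrals. *)
Lemma normr_increment_le (F f Phi phi : R -> R) (a b : R) : a <= b ->
  (forall t : R, a <= t <= b -> is_derive t 1 F (f t)) ->
  (forall t : R, a <= t <= b -> is_derive t 1 Phi (phi t)) ->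
  (forall t, a <= t <= b -> `|f t| <= phi t) ->
  `|F b - F a| <= Phi b - Phi a.
Proof.
move=> ab dF dPhi fphi.
have mono (s : R) : `|s| = 1 -> Phi a - s * F a <= Phi b - s * F b.
  move=> s1; pose H (t : R) := s * F t + -1 * Phi t.
  have dH (t : R) : a <= t <= b -> is_derive t 1 H (s * f t + -1 * phi t).
    by move=> tab; apply: is_derive1D; apply: is_derive1Z; [exact: dF|exact: dPhi].
  suff : H b <= H a by rewrite /H; lra.
  apply: nonincreasing_endpoints => //.
    apply: (is_derive_within_continuous H (fun t => s * f t + -1 * phi t)) => t.
  move=> t /andP[at_ tb]; have tab : a <= t <= b by rewrite !ltW.
  exists (s * f t + -1 * phi t); split; first exact: dH.
  rewrite mulN1r subr_le0 (le_trans _ (fphi t tab))// (le_trans (ler_norm _))//.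
  by rewrite normrM s1 mul1r.
have := mono 1; have := mono (-1); rewrite normrN normr1 => /(_ erefl) h1 /(_ erefl) h2.
by rewrite ler_norml; apply/andP; split; lra.
Qed.

Lemma is_derive1_expR_affine (a t0 t : R) :
  is_derive t 1 (fun s : R => expR (a * (s - t0))) (a * expR (a * (t - t0))).
Proof.
have -> : (fun s : R => expR (a * (s - t0))) = expR \o (fun s => a * s + - (a * t0)).
  by apply/funext => s /=; rewrite mulrBr.
apply: (is_derive_eq (is_derive1_comp (is_derive_expR _) (is_derive1_affine a _ t))).
by rewrite mulrC mulrBr.
Qed.

(** A quantity that decays exponentially as long as it has stayed below the
barrier [m] never reaches the barrier: at a first contact time the decay up to
that time would leave it no larger than its initial value, hence below [m]. *)
Lemma barrier_exponential_decay (g : R -> R) (t0 m gam : R) : 0 <= gam ->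
  continuous g -> 0 <= g t0 -> g t0 < m ->
  (forall t : R, t0 < t -> (forall s, t0 <= s <= t -> g s < m) ->
    exists d, is_derive t 1 g d /\ d <= - gam * g t) ->
  forall t, t0 <= t -> g t < m /\ g t <= g t0 * expR (- gam * (t - t0)).
Proof.
move=> gam0 cg g0 gm dg.
have decay (t1 : R) : t0 <= t1 -> (forall s, t0 <= s < t1 -> g s < m) ->
    g t1 <= g t0 * expR (- gam * (t1 - t0)).
  move=> t01 gs; pose H (t : R) := g t * expR (gam * (t - t0)).
  suff : H t1 <= H t0.
    rewrite /H subrr mulr0 expR0 mulr1 mulNr expRN.
    by rewrite ler_pdivlMr// expR_gt0.
  have dH (t : R) : t0 < t < t1 -> exists d : R, is_derive t 1 H d /\ d <= 0.
    move=> /andP[t0t tt1]; have gst s : t0 <= s <= t -> g s < m.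
      by move=> /andP[s0 st]; apply: gs; rewrite s0 (le_lt_trans st).
    have [d [dgt dle]] := dg t t0t gst.
    exists (d * expR (gam * (t - t0)) + g t * (gam * expR (gam * (t - t0)))).
    split; first exact: is_derive1M dgt (is_derive1_expR_affine _ _ _).
    rewrite mulrA -mulrDl pmulr_lle0 ?expR_gt0//.
    by rewrite (mulrC (g t)); move: dle; rewrite mulNr; lra.
  apply: nonincreasing_endpoints => //.
  apply: continuous_subspaceT => t.
  exact: (continuousM (cg t) (is_derive_continuous _ _ _ (is_derive1_expR_affine gam t0 t))).
have below t : t0 <= t -> g t < m.
  move=> t0t; rewrite ltNge; apply/negP => mgt.
  pose E := [set s | t0 <= s /\ m <= g s].
  have E0 : E !=set0 by exists t.
  have iE : has_inf E by split=> //; exists t0 => s [].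
  have t01 : t0 <= inf E by apply: lb_le_inf => // s [].
  have gE : g (inf E) < m.
    apply: le_lt_trans gm; apply: (le_trans (decay _ t01 _)).
      move=> s /andP[t0s sE]; rewrite ltNge; apply/negP => mgs.
      by move: sE; rewrite ltNge => /negP; apply; apply: ge_inf; [case: iE|].
    rewrite ler_piMr// -expR0 ler_expR mulNr oppr_le0 mulr_ge0// subr_ge0//.
  have : \forall s \near inf E, g s < m by apply: (cvgr_lt _ (cg (inf E))).
  move=> [/= e e0 he]; have [s [t0s mgs] se] := inf_adherent e0 iE.
  have Es : inf E <= s by apply: ge_inf; [case: iE|].
  have : g s < m by apply: he; rewrite /= ltr_distlC; apply/andP; split; lra.
  by rewrite ltNge mgs.
move=> t t0t; split; first exact: below.
by apply: decay => // s /andP[t0s _]; exact: below.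
Qed.

End ComparisonPrinciples.

(** * Global solutions of bounded Lipschitz systems *)

Section Picard.
Local Open Scope classical_set_scope.
Local Open Scope ring_scope.
Context {R : realType}.

Lemma le_of_geometric_slack (a b c : R) : (forall k, a <= b + c / 2 ^+ k) -> a <= b.
Proof.
move=> h.
have cv : b + geometric c 2^-1 n @[n --> \oo] --> b + 0.
  apply: cvgD; first exact: cvg_cst.
  by apply: cvg_geometric; rewrite ger0_norm//; lra.
rewrite addr0 in cv; apply: (cvgr_to_ge cv); apply: nearW => k.
by rewrite /geometric /= exprVn; exact: h.
Qed.

Lemma geometric_increments_cvg (u : nat -> R) (c : R) :
  (forall k, `|u k.+1 - u k| <= c / 2 ^+ k) ->
  exists l, forall k, `|l - u k| <= 2 * c / 2 ^+ k.
Proof.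
move=> uc.
have c0 : 0 <= c by have := uc 0; rewrite expr0 divr1; apply: le_trans.
have diff k j : `|u (k + j)%N - u k| <= 2 * c / 2 ^+ k * (1 - 2^-1 ^+ j).
  elim: j => [|j ih]; first by rewrite addn0 subrr normr0 expr0 subrr mulr0.
  rewrite addnS -(subrK (u (k + j)%N) (u _.+1)) -addrA.
  apply: (le_trans (ler_normD _ _)); apply: (le_trans (lerD (uc _) ih)).
  rewrite exprD invfM exprS exprVn.
  move: (2 ^+ k)^-1 (2 ^+ j)^-1 => x y.
  rewrite le_eqVlt; apply/orP; left; apply/eqP; by field.
have diff' k j : `|u (k + j)%N - u k| <= 2 * c / 2 ^+ k.
  apply: (le_trans (diff k j)); rewrite ler_piMr//.
  by rewrite divr_ge0 ?mulr_ge0 ?exprn_ge0.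
have cu : cvgn u.
  have -> : u = (fun n => u 0 + series (telescope u) n).
    by apply/funext => n; exact: eq_sum_telescope.
  apply: is_cvgD; first exact: is_cvg_cst.
  apply: normed_cvg.
  apply: (@series_le_cvg _ _ (geometric c 2^-1)) => [n|n|n|].
  - exact: normr_ge0.
  - by rewrite /geometric /= mulr_ge0// exprn_ge0// invr_ge0.
  - by rewrite /geometric /= exprVn /telescope; exact: uc.
  - by apply: is_cvg_geometric_series; rewrite ger0_norm//; lra.
exists (limn u) => k.
have cd : `|u n - u k| @[n --> \oo] --> `|limn u - u k|.
  by apply: cvg_norm; apply: cvgB => //; exact: cvg_cst.
apply: (cvgr_to_le cd); near=> n.
have kn : (k <= n)%N by near: n; exact: nbhs_infty_ge.
by rewrite -(subnKC kn); exact: diff'.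
Unshelve. all: by end_near. Qed.

Context {n : nat}.
Implicit Types (X h : R -> 'cV[R]_n) (x y : 'cV[R]_n).

(** Closeness in the maximum norm, spelled out on coordinates because fields
and their integrals are estimated one coordinate at a time. *)
Definition near_col (c : R) x y := forall i, `|x i 0 - y i 0| <= c.
Definition col_continuous X := forall i, continuous (fun t => X t i 0).

Lemma col_antiderivative (t0 : R) x0 : exists P : (R -> 'cV[R]_n) -> R -> 'cV[R]_n,
  forall h, col_continuous h -> P h t0 = x0 /\
    forall (t : R) i, t0 <= t -> is_derive t 1 (fun s => P h s i 0) (h t i 0).
Proof.
suff /choice[P hP] : forall h, exists H : R -> 'cV[R]_n, col_continuous h -> H t0 = x0 /\
    forall (t : R) i, t0 <= t -> is_derive t 1 (fun s => H s i 0) (h t i 0) by exists P.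
move=> h; have [ch|nch] := pselect (col_continuous h); last by exists (fun=> x0).
have A i := cid (antiderivative_exists _ (t0 - 1) (ch i)).
exists (fun t => \col_i (sval (A i) t + (x0 i 0 - sval (A i) t0))) => _; split.
  by apply/colP => i; rewrite mxE addrC subrK.
move=> t i t0t.
have -> : (fun s => (\col_j (sval (A j) s + (x0 j 0 - sval (A j) t0))) i 0)
  = (fun s => sval (A i) s + (x0 i 0 - sval (A i) t0)) by apply/funext => s; rewrite mxE.
apply: (is_derive_eq (is_derive1D _ _ _ _ _ (svalP (A i) t _) (is_derive_cst _ t 1))).
  by rewrite (lt_le_trans _ t0t)// gtrBl.
by rewrite addr0.
Qed.

(** Picard iteration.  Measured with the weight [expR (2 * L * (t - t0))],
integration of an [L]-Lipschitz field is a contraction by one half, so the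
iterates converge geometrically at each time, without restriction on the time
interval.  A bounded field makes all iterates Lipschitz with the same
constant, hence their pointwise limit is continuous. *)
Theorem global_cauchy_lipschitz (f : R -> 'cV[R]_n -> 'cV[R]_n) (B L t0 : R) x0 :
  (forall t x i, `|f t x i 0| <= B) ->
  (forall t c x y, 0 <= c -> near_col c x y -> near_col (L * c) (f t x) (f t y)) ->
  (forall X, col_continuous X -> col_continuous (fun t => f t (X t))) ->
  exists X, X t0 = x0 /\
    forall (t : R) i, t0 <= t -> is_derive t 1 (fun s => X s i 0) (f t (X t) i 0).
Proof.
move=> fB fL fC.
have [P hP] := col_antiderivative t0 x0.
pose step X (t : R) := P (fun s => f s (X s)) (Num.max t0 t).
pose X k := iter k step (fun=> x0).
have cX k : col_continuous (X k).
  elim: k => [|k ih] i; first by move=> t; exact: cvg_cst.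
  have [_ dP] := hP _ (fC _ ih).
  move=> t; apply: (@continuous_comp _ _ _ (fun t : R => Num.max t0 t)
    (fun s => P (fun s => f s (X k s)) s i 0)).
    by apply: (@continuous_max R R (fun=> t0) id); [exact: cvg_cst|exact: cvg_id].
  by apply: is_derive_continuous; apply: dP; rewrite le_max lexx.
have dX k (t : R) i : t0 <= t ->
    is_derive t 1 (fun s => P (fun s => f s (X k s)) s i 0) (f t (X k t) i 0).
  by move=> t0t; have [_ dP] := hP _ (fC _ (cX k)); exact: dP.
have XS k (t : R) : t0 <= t -> X k.+1 t = P (fun s => f s (X k s)) t.
  by move=> t0t; rewrite /X /= /step max_r.
have X0 k : P (fun s => f s (X k s)) t0 = x0 by have [] := hP _ (fC _ (cX k)).
(* In dimension zero nothing forces B to be nonnegative. *)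
have B0 : 0 <= B \/ forall i : 'I_n, False.
  case: (pselect (exists i : 'I_n, True)) => [[i _]|ni]; last by right => i; apply: ni; exists i.
  by left; apply: le_trans (fB t0 x0 i).
case: B0 => [B0|n0]; last by exists (fun=> x0); split=> // t i; case: (n0 i).
pose l : R := `|L| + 1.
have l0 : 0 < l by rewrite /l ltr_wpDl.
have fl t c x y i : 0 <= c -> near_col c x y -> `|f t x i 0 - f t y i 0| <= l * c.
  move=> c0 xy; apply: (le_trans (fL _ _ _ _ c0 xy i)).
  by rewrite ler_wpM2r// /l (le_trans (ler_norm L))// lerDl.
(* This C makes the first increment fit the geometric bound. *)
pose C := B / (2 * l).
have C0 : 0 <= C by rewrite divr_ge0// mulr_ge0// ltW.
pose w (t : R) := expR (2 * l * (t - t0)).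
have w0 t : 0 < w t by exact: expR_gt0.
have w1 t : t0 <= t -> 1 <= w t.
  by move=> t0t; rewrite /w -expR0 ler_expR !mulr_ge0 ?subr_ge0// ltW.
have dw (a t : R) : is_derive t 1 (fun s => a * w s) (a * (2 * l * w t)).
  exact/is_derive1Z/is_derive1_expR_affine.
(* Integrating l * (a * w) gives a / 2 * w, since w' = 2 * l * w. *)
have contract h1 h2 (a t : R) i : col_continuous h1 -> col_continuous h2 -> 0 <= a ->
    t0 <= t -> (forall s, t0 <= s -> `|h1 s i 0 - h2 s i 0| <= l * (a * w s)) ->
    `|P h1 t i 0 - P h2 t i 0| <= a / 2 * w t.
  move=> c1 c2 a0 t0t h12.
  have [P1 d1] := hP _ c1; have [P2 d2] := hP _ c2.
  have := @normr_increment_le R (fun s => P h1 s i 0 + -1 * P h2 s i 0)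
    (fun s => h1 s i 0 + -1 * h2 s i 0) (fun s => a / 2 * w s)
    (fun s => a / 2 * (2 * l * w s)) t0 t t0t.
  rewrite P1 P2 !mulN1r subrr subr0 => H.
  have d12 (s : R) : t0 <= s <= t ->
      is_derive s 1 (fun s => P h1 s i 0 + -1 * P h2 s i 0) (h1 s i 0 + -1 * h2 s i 0).
    by move=> /andP[t0s _]; apply: is_derive1D; [exact: d1|apply: is_derive1Z; exact: d2].
  have b12 s : t0 <= s <= t -> `|h1 s i 0 + -1 * h2 s i 0| <= a / 2 * (2 * l * w s).
    move=> /andP[t0s _]; rewrite mulN1r (le_trans (h12 s t0s))//.
    have -> : a / 2 * (2 * l * w s) = l * (a * w s) by field.
    exact: lexx.
  apply: (le_trans (H d12 (fun s _ => dw _ s) b12)).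
  by rewrite gerBl mulr_ge0// ?divr_ge0// ltW.
have Ck k : 0 <= C / 2 ^+ k by apply: divr_ge0; last exact: exprn_ge0.
have incr k (t : R) : t0 <= t -> near_col (C / 2 ^+ k * w t) (X k.+1 t) (X k t).
  elim: k t => [|k ih] t t0t i.
    have := @normr_increment_le R (fun s => P (fun s => f s (X 0 s)) s i 0)
      (fun s => f s (X 0 s) i 0) (fun s => C * w s) (fun s => C * (2 * l * w s)) t0 t t0t.
    rewrite X0 -XS// => H; rewrite expr0 divr1.
    have d0 (s : R) : t0 <= s <= t ->
        is_derive s 1 (fun s => P (fun s => f s (X 0 s)) s i 0) (f s (X 0 s) i 0).
      by move=> /andP[t0s _]; exact: dX.
    have b0 s : t0 <= s <= t -> `|f s (X 0 s) i 0| <= C * (2 * l * w s).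
      move=> /andP[t0s _]; have -> : C * (2 * l * w s) = B * w s.
        by rewrite /C; field; rewrite gt_eqF.
      by rewrite (le_trans (fB _ _ _))// ler_peMr// w1.
    apply: (le_trans (H d0 (fun s _ => dw _ s) b0)).
    by rewrite gerBl mulr_ge0// ltW.
  rewrite !XS//.
  have -> : C / 2 ^+ k.+1 * w t = (C / 2 ^+ k) / 2 * w t.
    by rewrite exprS; field; rewrite expf_neq0.
  apply: contract => //; [exact/fC/cX|exact/fC/cX|].
  move=> s t0s; apply: fl; last exact: ih.
  by apply: mulr_ge0; last exact/ltW.
have lim (t : R) i : exists z : R, t0 <= t -> forall k, `|z - X k t i 0| <= 2 * (C * w t) / 2 ^+ k.
  have [t0t|] := boolP (t0 <= t); last by exists 0.
  have bk k : `|X k.+1 t i 0 - X k t i 0| <= C * w t / 2 ^+ k.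
    by rewrite mulrAC; exact: incr.
  by have [z hz] := geometric_increments_cvg (fun k => X k t i 0) _ bk; exists z.
have /choice[Z hZ] : forall t : R, exists z : 'cV[R]_n, t0 <= t ->
    forall k, near_col (2 * (C * w t) / 2 ^+ k) z (X k t).
  move=> t; have A i := cid (lim t i).
  by exists (\col_i sval (A i)) => t0t k i; rewrite mxE; exact: (svalP (A i)).
pose Y (t : R) := Z (Num.max t0 t).
have YE t : t0 <= t -> Y t = Z t by move=> t0t; rewrite /Y max_r.
have XB k (s t : R) i : t0 <= s -> s <= t -> `|X k t i 0 - X k s i 0| <= B * (t - s).
  case: k => [|k] t0s st; first by rewrite subrr normr0 mulr_ge0// subr_ge0.
  have t0t := le_trans t0s st; rewrite !XS//.
  have := @normr_increment_le R (fun s => P (fun s => f s (X k s)) s i 0)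
      (fun s => f s (X k s) i 0) (fun s => B * s + 0) (fun s => B) s t st.
  rewrite !addr0 -mulrBr => H; apply: H => [r /andP[sr _]|r _|r _].
  - exact/dX/(le_trans t0s).
  - exact: is_derive1_affine.
  - exact: fB.
have ZB (s t : R) i : t0 <= s -> s <= t -> `|Z t i 0 - Z s i 0| <= B * (t - s).
  move=> t0s st; have t0t := le_trans t0s st.
  apply: (@le_of_geometric_slack _ _ (2 * (C * w t) + 2 * (C * w s))) => k.
  have := hZ t t0t k i; have := hZ s t0s k i; have := XB k s t i t0s st.
  rewrite mulrDl !ler_norml; lra.
have cY : col_continuous Y.
  move=> i t; apply/cvgrPdist_le => e e0.
  have be : 0 < e / (B + 1) by rewrite divr_gt0// ltr_wpDl.
  near=> s.
  have sB : `|Num.max t0 t - Num.max t0 s| <= e / (B + 1).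
    have : `|t - s| < e / (B + 1) by near: s; exact: cvgr_dist_lt (@cvg_id _ _) _ be.
    by move=> /ltW; apply: le_trans; exact: normr_maxB_le.
  have key (a b : R) : t0 <= a -> t0 <= b -> `|Z a i 0 - Z b i 0| <= B * `|a - b|.
    move=> t0a t0b; case/orP: (le_total a b) => ab.
      by rewrite distrC (distrC a) (ger0_norm (_ : 0 <= b - a)) ?subr_ge0//; exact: ZB.
    by rewrite (ger0_norm (_ : 0 <= a - b)) ?subr_ge0//; exact: ZB.
  apply: (le_trans (key _ _ _ _)); rewrite ?le_max ?lexx//.
  have := ler_wpM2l B0 sB; move=> /le_trans; apply.
  rewrite mulrA ler_pdivrMr ?ltr_wpDl//; move: e0 => /=; lra.
have ZP (t : R) : t0 <= t -> Z t = P (fun s => f s (Y s)) t.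
  move=> t0t; apply/colP => i; apply/eqP; rewrite -subr_eq0 -normr_le0.
  apply: (@le_of_geometric_slack _ _ (2 * (C * w t))) => k; rewrite add0r.
  have h1 := hZ t t0t k.+1 i; rewrite XS// in h1.
  have h2 : `|P (fun s => f s (X k s)) t i 0 - P (fun s => f s (Y s)) t i 0|
      <= (2 * C / 2 ^+ k) / 2 * w t.
    apply: contract => //; [exact/fC/cX|exact: fC|by rewrite -mulrA mulr_ge0|].
    move=> s t0s; apply: fl => [|j]; first by rewrite -mulrA -mulrA mulr_ge0// mulrA mulr_ge0// ltW.
    rewrite YE// distrC (le_trans (hZ s t0s k j))//.
    by have -> : 2 * C / 2 ^+ k * w s = 2 * (C * w s) / 2 ^+ k by field; rewrite expf_neq0.
  apply: (le_trans (ler_distD (P (fun s => f s (X k s)) t i 0) _ _)).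
  apply: (le_trans (lerD h1 h2)).
  rewrite exprS; have -> : 2 * (C * w t) / (2 * 2 ^+ k) + 2 * C / 2 ^+ k / 2 * w t
    = 2 * (C * w t) / 2 ^+ k by field; rewrite expf_neq0.
  exact: lexx.
have [PY0 dPY] := hP _ (fC _ cY).
exists (P (fun s => f s (Y s))); split=> // t i t0t.
by rewrite -ZP// -(YE t t0t); exact: dPY.
Unshelve. all: by end_near. Qed.

End Picard.

(** * Clipped fields *)

Section TameFields.
Local Open Scope classical_set_scope.
Local Open Scope ring_scope.
Context {R : realType} {n : nat}.
Implicit Types (h k : R * 'cV[R]_n -> R) (x y : 'cV[R]_n).

(** What Picard iteration asks of each coordinate of a vector field.  The third
clause replaces joint continuity in time and state. *)
Definition tame h : Prop :=
  [/\ exists B, forall a, `|h a| <= B,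
      exists L, 0 <= L /\ forall t c x y, 0 <= c -> near_col c x y ->
        `|h (t, x) - h (t, y)| <= L * c &
      forall X : R -> 'cV[R]_n, col_continuous X -> continuous (fun t => h (t, X t))].

Lemma tame_algebra : function_algebra tame.
Proof.
split=> [c|h k [[B hB] [L [L0 hL]] hC] [[B' kB] [L' [L'0 kL]] kC]
  |h k [[B hB] [L [L0 hL]] hC] [[B' kB] [L' [L'0 kL]] kC]].
- split; first by exists `|c|.
    by exists 0; split=> // *; rewrite subrr normr0 mul0r.
  by move=> X _ t; exact: cvg_cst.
- split; first by exists (B + B') => a; rewrite (le_trans (ler_normD _ _))// lerD.
    exists (L + L'); split=> [|t c x y c0 xy]; first exact: addr_ge0.
    by rewrite opprD addrACA (le_trans (ler_normD _ _))// mulrDl lerD// ?hL// kL.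
  by move=> X cX t; exact: (continuousD (hC X cX t) (kC X cX t)).
- have B0 : 0 <= B by apply: le_trans (hB (0, 0)).
  have B'0 : 0 <= B' by apply: le_trans (kB (0, 0)).
  split; first by exists (B * B') => a; rewrite normrM ler_pM.
    exists (B * L' + B' * L); split=> [|t c x y c0 xy].
      by rewrite addr_ge0// mulr_ge0.
    have -> : h (t, x) * k (t, x) - h (t, y) * k (t, y) =
      h (t, x) * (k (t, x) - k (t, y)) + k (t, y) * (h (t, x) - h (t, y)) by ring.
    rewrite (le_trans (ler_normD _ _))// !normrM mulrDl -!mulrA lerD// ler_pM//.
    + exact: kL.
    + exact: hL.
  by move=> X cX t; exact: (continuousM (hC X cX t) (kC X cX t)).
Qed.

Lemma tame_time (f : R -> R) : continuous f -> (exists B, forall t, `|f t| <= B) ->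
  tame (fun a => f a.1).
Proof.
move=> cf [B fB]; split; first by exists B => a; exact: fB.
  by exists 0; split=> // *; rewrite subrr normr0 mul0r.
by move=> X _; exact: cf.
Qed.

(** Polynomial fields become bounded and globally Lipschitz when their
arguments are clipped; the bound 2 leaves the states at distance less than 1
from the equilibrium, which has coordinates 0 and 1, unchanged. *)
Definition clip (r : R) : R := Num.max (-2) (Num.min 2 r).

Lemma normr_clip r : `|clip r| <= 2.
Proof. by rewrite ler_norml /clip le_max lexx ge_max ge_min lexx /=; lra. Qed.

Lemma clip_id r : `|r| <= 2 -> clip r = r.
Proof. by rewrite ler_norml => /andP[r1 r2]; rewrite /clip min_r// max_r. Qed.

Lemma clip_lipschitz r s : `|clip r - clip s| <= `|r - s|.
Proof.
exact: le_trans (normr_maxB_le _ _ _) (normr_minB_le _ _ _).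
Qed.

Lemma clip_continuous : continuous clip.
Proof.
move=> r; apply/cvgrPdist_le => e e0; near=> s.
apply: (le_trans (clip_lipschitz _ _)); apply: ltW.
by near: s; exact: cvgr_dist_lt (@cvg_id _ _) _ e0.
Unshelve. all: by end_near. Qed.

Definition clip_col x : 'cV[R]_n := \col_i clip (x i 0).

Lemma entrywise_tame_clip : entrywise tame _ _ (fun a : R * 'cV[R]_n => clip_col a.2).
Proof.
move=> i j; apply: (eq_fun_alg tame (fun a => clip (a.2 i 0))) => [a|]; first by rewrite mxE.
split; first by exists 2 => a; exact: normr_clip.
  exists 1; split=> // t c x y _ xy; rewrite mul1r.
  exact: le_trans (clip_lipschitz _ _) (xy i).
move=> X cX t; apply: continuous_comp; [exact: cX|exact: clip_continuous].
Qed.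

Lemma tame_field_solution (f : R * 'cV[R]_n -> 'cV[R]_n) (t0 : R) x0 :
  entrywise tame _ _ f ->
  exists X, X t0 = x0 /\
    forall (t : R) i, t0 <= t -> is_derive t 1 (fun s => X s i 0) (f (t, X t) i 0).
Proof.
move=> tf.
have B i : exists B, forall a, `|f a i 0| <= B by have [] := tf i 0.
have L i : exists L, 0 <= L /\ forall t c x y, 0 <= c -> near_col c x y ->
    `|f (t, x) i 0 - f (t, y) i 0| <= L * c by have [] := tf i 0.
pose b i := sval (cid (B i)); pose l i := sval (cid (L i)).
have b0 i : 0 <= b i by apply: le_trans (svalP (cid (B i)) (0, 0)).
have l0 i : 0 <= l i by have [] := svalP (cid (L i)).
apply: (@global_cauchy_lipschitz R n (fun t x => f (t, x)) (\sum_i b i) (\sum_i l i)).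
- move=> t x i; apply: (le_trans (svalP (cid (B i)) _)).
  by rewrite -/(b i) (bigD1 i)//= lerDl sumr_ge0.
- move=> t c x y c0 xy i; have [_ /(_ t c x y c0 xy)] := svalP (cid (L i)).
  move=> /le_trans; apply; rewrite -/(l i) ler_wpM2r// (bigD1 i)//= lerDl.
  by rewrite sumr_ge0.
- by move=> X cX i; have [_ _] := tf i 0; exact.
Qed.

End TameFields.

(** * Derivatives of matrix-valued functions *)

Section MatrixDerivatives.
Context {R : realType}.
Implicit Type t : R.

Definition mx_derive m n t (X : R -> 'M[R]_(m, n)) (X' : 'M[R]_(m, n)) : Prop :=
  forall i j, is_derive t 1 (fun s => X s i j) (X' i j).

Lemma mx_derive_eq m n t (X : R -> 'M[R]_(m, n)) X' Y' :
  mx_derive _ _ t X X' -> X' = Y' -> mx_derive _ _ t X Y'.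
Proof. by move=> ? <-. Qed.

Lemma mx_deriveD m n t (X Y : R -> 'M[R]_(m, n)) X' Y' :
  mx_derive _ _ t X X' -> mx_derive _ _ t Y Y' ->
  mx_derive _ _ t (fun s => X s + Y s) (X' + Y').
Proof.
move=> dX dY i j; rewrite mxE.
have -> : (fun s => (X s + Y s) i j) = (fun s => X s i j + Y s i j).
  by apply/funext => s; rewrite mxE.
exact: is_derive1D.
Qed.

Lemma mx_deriveZ m n t a (X : R -> 'M[R]_(m, n)) X' :
  mx_derive _ _ t X X' -> mx_derive _ _ t (fun s => a *: X s) (a *: X').
Proof.
move=> dX i j; rewrite mxE.
have -> : (fun s => (a *: X s) i j) = (fun s => a * X s i j).
  by apply/funext => s; rewrite mxE.
exact: is_derive1Z.
Qed.

Lemma mx_derive_cst m n t (M : 'M[R]_(m, n)) : mx_derive _ _ t (fun=> M) 0.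
Proof. by move=> i j; rewrite mxE; exact: is_derive_cst. Qed.

Lemma is_derive1_sum n t (F : 'I_n -> R -> R) (dF : 'I_n -> R) :
  (forall i, is_derive t 1 (F i) (dF i)) ->
  is_derive t 1 (fun s => \sum_i F i s) (\sum_i dF i).
Proof.
move=> hF; have -> : (fun s => \sum_i F i s) = \sum_i F i.
  by apply/funext => s; rewrite fct_sumE.
exact: is_derive_sum.
Qed.

Lemma mx_deriveM m n p t (X : R -> 'M[R]_(m, n)) (Y : R -> 'M[R]_(n, p)) X' Y' :
  mx_derive _ _ t X X' -> mx_derive _ _ t Y Y' ->
  mx_derive _ _ t (fun s => X s *m Y s) (X' *m Y t + X t *m Y').
Proof.
move=> dX dY i j; rewrite !mxE -big_split /=.
have -> : (fun s => (X s *m Y s) i j) = (fun s => \sum_k X s i k * Y s k j).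
  by apply/funext => s; rewrite mxE.
by apply: is_derive1_sum => k; exact: is_derive1M.
Qed.

Lemma mx_derive_mulmx m n p t (M : 'M[R]_(m, n)) (Y : R -> 'M[R]_(n, p)) Y' :
  mx_derive _ _ t Y Y' -> mx_derive _ _ t (fun s => M *m Y s) (M *m Y').
Proof.
move=> dY; apply: mx_derive_eq (mx_deriveM _ _ _ _ _ _ _ _ (mx_derive_cst _ _ t M) dY) _.
by rewrite mul0mx add0r.
Qed.

Lemma is_derive1_dotv n t (u v : R -> 'cV[R]_n) u' v' :
  mx_derive _ _ t u u' -> mx_derive _ _ t v v' ->
  is_derive t 1 (fun s => dotv (u s) (v s)) (dotv u' (v t) + dotv (u t) v').
Proof.
move=> du dv.
have dut : mx_derive _ _ t (fun s => (u s)^T) u'^T.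
  move=> i j; rewrite mxE; have -> : (fun s => (u s)^T i j) = (fun s => u s j i).
    by apply/funext => s; rewrite mxE.
  exact: du.
have := mx_deriveM _ _ _ _ _ _ _ _ dut dv 0 0.
by rewrite /dotv [in X in is_derive _ _ _ X -> _]mxE.
Qed.

Lemma mx_derive_usub m n p t (X : R -> 'M[R]_(m + n, p)) X' :
  mx_derive _ _ t X X' -> mx_derive _ _ t (fun s => usubmx (X s)) (usubmx X').
Proof.
move=> dX i j; rewrite mxE.
have -> : (fun s => usubmx (X s) i j) = (fun s => X s (lshift n i) j).
  by apply/funext => s; rewrite mxE.
exact: dX.
Qed.

Lemma mx_derive_dsub m n p t (X : R -> 'M[R]_(m + n, p)) X' :
  mx_derive _ _ t X X' -> mx_derive _ _ t (fun s => dsubmx (X s)) (dsubmx X').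
Proof.
move=> dX i j; rewrite mxE.
have -> : (fun s => dsubmx (X s) i j) = (fun s => X s (rshift m i) j).
  by apply/funext => s; rewrite mxE.
exact: dX.
Qed.

End MatrixDerivatives.

(** * A Lyapunov function for the closed loop *)

Section LyapunovFunction.
Context {R : realType}.
Variables (G J : 'M[R]_3) (k1 k2 delta : R).
Implicit Types (z w : 'cV[R]_3) (Delta : 'M[R]_3).

Definition feedback z w : 'cV[R]_3 := k1 *: z + k2 *: w.

(** The first three terms are the energy of the averaged loop with a small
cross term, which makes the decay rate definite also in [z].  The fourth
replaces a near-identity change of variables: its derivative trades the
instantaneous [Gamma t] for its average [G], up to terms of higher order in
[eps]. *)
Definition lyapunov (eps : R) Delta z w (p : R) : R :=
  (k1 + delta * k2) * dotv z (G *m z) + 2^-1 * dotv w (J *m w)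
  + delta * dotv z (J *m w)
  + eps * dotv (w + delta *: z) (Delta *m feedback z w) + p * p.

(** The derivative of [lyapunov] divided by [eps], when [z' = eps * zeta],
[w' = eps * eta], [Delta' = osc] and [p' = eps / 2 * (z . w)]; [p] stands for
one minus the scalar part of the quaternion. *)
Definition lyapunov_rate (eps : R) Delta (osc : 'M[R]_3) z w (p : R) (zeta eta : 'cV[R]_3) : R :=
  (k1 + delta * k2) * (dotv zeta (G *m z) + dotv z (G *m zeta))
  + 2^-1 * (dotv eta (J *m w) + dotv w (J *m eta))
  + delta * (dotv zeta (J *m w) + dotv z (J *m eta))
  + dotv (w + delta *: z) (osc *m feedback z w)
  + eps * (dotv (eta + delta *: zeta) (Delta *m feedback z w)
           + dotv (w + delta *: z) (Delta *m feedback zeta eta))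
  + p * dotv z w.

Lemma is_derive1_lyapunov (eps t : R) (D osc : R -> 'M[R]_3) (z w : R -> 'cV[R]_3)
    (p : R -> R) zeta eta :
  mx_derive _ _ t D (osc t) ->
  mx_derive _ _ t z (eps *: zeta) -> mx_derive _ _ t w (eps *: eta) ->
  is_derive t 1 p (eps * (2^-1 * dotv (z t) (w t))) ->
  is_derive t 1 (fun s => lyapunov eps (D s) (z s) (w s) (p s))
    (eps * lyapunov_rate eps (D t) (osc t) (z t) (w t) (p t) zeta eta).
Proof.
move=> dD dz dw dp.
have dy : mx_derive _ _ t (fun s => feedback (z s) (w s)) (eps *: feedback zeta eta).
  apply: mx_derive_eq (mx_deriveD _ _ _ _ _ _ _ (mx_deriveZ _ _ _ k1 _ _ dz) (mx_deriveZ _ _ _ k2 _ _ dw)) _.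
  by rewrite /feedback scalerDr !scalerA (mulrC k1) (mulrC k2).
have dwz : mx_derive _ _ t (fun s => w s + delta *: z s) (eps *: (eta + delta *: zeta)).
  apply: mx_derive_eq (mx_deriveD _ _ _ _ _ _ _ dw (mx_deriveZ _ _ _ delta _ _ dz)) _.
  by rewrite scalerDr !scalerA (mulrC delta).
have dDy := mx_deriveM _ _ _ _ _ _ _ _ dD dy.
have dzGz := is_derive1_dotv _ _ _ _ _ _ dz (mx_derive_mulmx _ _ _ _ G _ _ dz).
have dwJw := is_derive1_dotv _ _ _ _ _ _ dw (mx_derive_mulmx _ _ _ _ J _ _ dw).
have dzJw := is_derive1_dotv _ _ _ _ _ _ dz (mx_derive_mulmx _ _ _ _ J _ _ dw).
have dcorr := is_derive1_dotv _ _ _ _ _ _ dwz dDy.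
apply: (is_derive_eq (is_derive1D _ _ _ _ _ (is_derive1D _ _ _ _ _ (is_derive1D _ _ _ _ _
  (is_derive1D _ _ _ _ _ (is_derive1Z (k1 + delta * k2) _ _ _ dzGz) (is_derive1Z 2^-1 _ _ _ dwJw))
  (is_derive1Z delta _ _ _ dzJw)) (is_derive1Z eps _ _ _ dcorr)) (is_derive1M _ _ _ _ _ dp dp))).
rewrite /lyapunov_rate -!scalemxAr !(dotvZl, dotvZr) [dotv _ (osc t *m _ + _)]dotvDr dotvZr.
by field.
Qed.

End LyapunovFunction.

(** * Energy estimates *)

Section EnergyEstimates.
Context {R : realType}.

Definition mx_bounded n (c : R) (M : 'M[R]_n) := forall v, enorm (M *m v) <= c * enorm v.

Lemma dotv_le n (u v : 'cV[R]_n) (a b : R) :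
  enorm u <= a -> enorm v <= b -> `|dotv u v| <= a * b.
Proof.
move=> ua vb; apply: (le_trans (cauchy_schwarz _ _ _)).
by apply: ler_pM; rewrite ?enorm_ge0.
Qed.

Lemma enorm_mulmx_le_trans n (c : R) (M : 'M[R]_n) v b : 0 <= c -> mx_bounded _ c M ->
  enorm v <= b -> enorm (M *m v) <= c * b.
Proof. by move=> c0 Mc vb; apply: (le_trans (Mc v)); rewrite ler_wpM2l. Qed.

Lemma enormD_le n (u v : 'cV[R]_n) a b :
  enorm u <= a -> enorm v <= b -> enorm (u + v) <= a + b.
Proof. by move=> ua vb; apply: (le_trans (enormD _ _ _)); exact: lerD. Qed.

Lemma enormZ_le n (u : 'cV[R]_n) (c a : R) : 0 <= c -> enorm u <= a -> enorm (c *: u) <= c * a.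
Proof. by move=> c0 ua; rewrite enormZ ger0_norm// ler_wpM2l. Qed.

Variables (G J : 'M[R]_3) (k1 k2 delta g Jm M : R).
Hypotheses (Gsym : G^T = G) (Jsym : J^T = J).
Hypotheses (g0 : 0 < g) (M0 : 0 < M) (Jm0 : 0 < Jm).
Hypotheses (k1_gt0 : 0 < k1) (k2_gt0 : 0 < k2) (delta0 : 0 < delta) (delta1 : delta <= 1).
Hypothesis gG : forall v, g * dotv v v <= dotv v (G *m v).
Hypothesis JmJ : forall v, Jm * dotv v v <= dotv v (J *m v).
Hypotheses (GM : mx_bounded _ M G) (JM : mx_bounded _ M J).
Hypotheses (dk2 : delta * M <= k2 * g) (dk1 : delta * M <= k1 * g) (dJ : delta * M <= Jm / 2).

Implicit Types (z w zeta eta : 'cV[R]_3) (Delta Gam : 'M[R]_3).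

Definition size2 z w : R := dotv z z + dotv w w.

Lemma size2_ge0 z w : 0 <= size2 z w.
Proof. by rewrite addr_ge0// dotv_ge0. Qed.

Lemma enorm_le_size z w : enorm z <= Num.sqrt (size2 z w) /\ enorm w <= Num.sqrt (size2 z w).
Proof. by split; apply: ler_wsqrtr; rewrite /size2 ?lerDl ?lerDr dotv_ge0. Qed.

Lemma enorm_feedback_le z w a b : enorm z <= a -> enorm w <= b ->
  enorm (feedback k1 k2 z w) <= k1 * a + k2 * b.
Proof. by move=> za wb; apply: enormD_le; apply: enormZ_le => //; exact: ltW. Qed.

(** The terms in the oscillating matrix [Gam - G] and those of the actual
matrix [Gam] in the dynamics combine into the averaged ones, and the cross
terms in [z] and [w] cancel by the choice of the weight [k1 + delta * k2]. *)
Lemma lyapunov_rateE (eps p : R) Delta Gam z w (n1 n2 : 'cV[R]_3) zeta eta :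
  zeta = 2^-1 *: w + n1 -> J *m eta = - (Gam *m feedback k1 k2 z w) + n2 ->
  lyapunov_rate G J k1 k2 delta eps Delta (Gam - G) z w p zeta eta =
  - (k2 * dotv w (G *m w) + delta * k1 * dotv z (G *m z) - delta / 2 * dotv w (J *m w))
  + (2 * (k1 + delta * k2) * dotv z (G *m n1) + dotv w n2
     + delta * dotv n1 (J *m w) + delta * dotv z n2 + p * dotv z w)
  + eps * (dotv (eta + delta *: zeta) (Delta *m feedback k1 k2 z w)
           + dotv (w + delta *: z) (Delta *m feedback k1 k2 zeta eta)).
Proof.
move=> zetaE Jeta; rewrite /lyapunov_rate.
move: (dotv (eta + delta *: zeta) (Delta *m _)) => r1.
move: (dotv _ (Delta *m feedback k1 k2 zeta eta)) => r2.
rewrite (dotv_sym _ J eta w)// Jeta (dotv_sym _ G zeta z)//.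
rewrite zetaE !mulmxBl !mulmxDr -!scalemxAr.
rewrite !(dotvDl, dotvDr, dotvZl, dotvZr, dotvNr) (dotv_sym _ G w z)//.
by field.
Qed.

(** The averaged part of the rate is negative definite once the cross-term
weight [delta] is at most [k2 * g / M].  The nonlinear residuals cost a
factor [s], the size of the state, and the derivative of the correction term a
factor [eps]; neither constant depends on the inertia matrix except through
its bounds. *)
Lemma lyapunov_rate_le (eps p s c2 c3 : R) Delta Gam z w (n1 n2 : 'cV[R]_3) zeta eta :
  0 <= eps -> 0 <= c2 -> 0 <= c3 -> mx_bounded _ M Delta ->
  zeta = 2^-1 *: w + n1 -> J *m eta = - (Gam *m feedback k1 k2 z w) + n2 ->
  s <= 1 -> `|p| <= s ->
  enorm n1 <= s * Num.sqrt (size2 z w) -> enorm n2 <= c2 * s * Num.sqrt (size2 z w) ->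
  enorm eta <= c3 * Num.sqrt (size2 z w) ->
  lyapunov_rate G J k1 k2 delta eps Delta (Gam - G) z w p zeta eta <=
  (- Num.min (k2 * g / 2) (delta * k1 * g)
   + (2 * (k1 + k2) * M + 2 * c2 + M + 1) * s
   + eps * ((c3 + 2) * (M * (k1 + k2)) + 2 * M * (2 * k1 + k2 * c3))) * size2 z w.
Proof.
move=> eps0 c20 c30 DM zetaE Jeta s1 ps n1s n2s etas.
have s0 : 0 <= s by apply: le_trans ps.
rewrite (lyapunov_rateE _ _ _ _ _ _ _ _ _ _ zetaE Jeta).
have NN : Num.sqrt (size2 z w) ^+ 2 = size2 z w by rewrite sqr_sqrtr// size2_ge0.
have [zN wN] := enorm_le_size z w.
have N0 : 0 <= Num.sqrt (size2 z w) by exact: sqrtr_ge0.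
have zzww : dotv z z + dotv w w = size2 z w by [].
move: (size2 z w) (Num.sqrt (size2 z w)) NN zN wN N0 zzww n1s n2s etas => N2 N NN zN wN N0 zzww n1s n2s etas.
have zetaN : enorm zeta <= 2 * N.
  rewrite zetaE; apply: (@le_trans _ _ (2^-1 * N + s * N)).
    by apply: enormD_le => //; apply: enormZ_le.
  by rewrite -mulrDl ler_wpM2r//; lra.
have d0 := ltW delta0.
have Mge0 := ltW M0.
have yN : enorm (feedback k1 k2 z w) <= (k1 + k2) * N.
  by rewrite mulrDl; exact: enorm_feedback_le.
have dzN x b : 0 <= b -> enorm x <= b -> enorm (delta *: x) <= b.
  by move=> b0 xb; apply: (le_trans (enormZ_le _ _ _ _ d0 xb)); rewrite ler_piMl.
have B1 := dotv_le _ _ _ _ _ zN (enorm_mulmx_le_trans _ _ _ _ _ Mge0 GM n1s).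
have B2 := dotv_le _ _ _ _ _ wN n2s.
have B3 := dotv_le _ _ _ _ _ n1s (enorm_mulmx_le_trans _ _ _ _ _ Mge0 JM wN).
have B4 := dotv_le _ _ _ _ _ zN n2s.
have B5 := dotv_le _ _ _ _ _ zN wN.
have B6 : `|dotv (eta + delta *: zeta) (Delta *m feedback k1 k2 z w)|
    <= (c3 * N + 2 * N) * (M * ((k1 + k2) * N)).
  apply: dotv_le; last exact: enorm_mulmx_le_trans.
  by apply: enormD_le => //; apply: dzN => //; rewrite mulr_ge0.
have B7 : `|dotv (w + delta *: z) (Delta *m feedback k1 k2 zeta eta)|
    <= (N + N) * (M * (k1 * (2 * N) + k2 * (c3 * N))).
  apply: dotv_le; first by apply: enormD_le => //; exact: dzN.
  by apply: enorm_mulmx_le_trans => //; exact: enorm_feedback_le.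
(* Half of the term in k2 absorbs the term of the wrong sign, in J. *)
have main : k2 * dotv w (G *m w) + delta * k1 * dotv z (G *m z) - delta / 2 * dotv w (J *m w)
    >= Num.min (k2 * g / 2) (delta * k1 * g) * N2.
  have m1 : Num.min (k2 * g / 2) (delta * k1 * g) <= k2 * g / 2 by rewrite ge_min lexx.
  have m2 : Num.min (k2 * g / 2) (delta * k1 * g) <= delta * k1 * g by rewrite ge_min lexx orbT.
  have w2 := dotv_ge0 w; have z2 := dotv_ge0 z.
  have h1 : k2 * (g * dotv w w) <= k2 * dotv w (G *m w) by rewrite ler_pM2l.
  have h2 : delta * k1 * (g * dotv z z) <= delta * k1 * dotv z (G *m z).
    by rewrite ler_pM2l// mulr_gt0.
  have h3 : dotv w (J *m w) <= M * dotv w w.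
    have := dotv_mulmx_le _ _ _ w w JM; rewrite -expr2 enorm_sqr.
    by move=> /(le_trans (ler_norm _)).
  have h4 : delta * dotv w (J *m w) <= k2 * g * dotv w w.
    apply: (@le_trans _ _ (delta * (M * dotv w w))); first by rewrite ler_pM2l.
    by rewrite mulrA ler_wpM2r.
  have h5 := ler_wpM2r w2 m1; have h6 := ler_wpM2r z2 m2.
  rewrite -zzww mulrDr; lra.
have lin (a x b : R) : 0 <= a -> `|x| <= b -> a * x <= a * b.
  by move=> a0 xb; rewrite ler_wpM2l// (le_trans (ler_norm x)).
have C1 := lin (2 * (k1 + delta * k2)) _ _ _ B1.
have C2 := lin 1 _ _ _ B2.
have C3 := lin delta _ _ _ B3.
have C4 := lin delta _ _ _ B4.
have sN2 : 0 <= s * N2 by rewrite mulr_ge0// -NN exprn_ge0.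
have C5 : p * dotv z w <= s * N2.
  apply: (le_trans (ler_norm _)); rewrite normrM -NN expr2.
  by apply: ler_pM.
have C6 : eps * (dotv (eta + delta *: zeta) (Delta *m feedback k1 k2 z w)
           + dotv (w + delta *: z) (Delta *m feedback k1 k2 zeta eta)) <=
    eps * (((c3 + 2) * (M * (k1 + k2)) + 2 * M * (2 * k1 + k2 * c3)) * N2).
  rewrite ler_wpM2l// -NN.
  have := le_trans (ler_norm _) B6; have := le_trans (ler_norm _) B7.
  have -> : (c3 * N + 2 * N) * (M * ((k1 + k2) * N)) = (c3 + 2) * (M * (k1 + k2)) * N ^+ 2 by ring.
  have -> : (N + N) * (M * (k1 * (2 * N) + k2 * (c3 * N))) = 2 * M * (2 * k1 + k2 * c3) * N ^+ 2 by ring.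
  by rewrite mulrDl; lra.
have D1 : 2 * (k1 + delta * k2) * dotv z (G *m n1) <= 2 * (k1 + k2) * M * (s * N2).
  apply: (le_trans (C1 _)).
    by rewrite mulr_ge0// addr_ge0 ?mulr_ge0// ltW.
  have -> : 2 * (k1 + delta * k2) * (N * (M * (s * N)))
    = 2 * M * (s * N ^+ 2) * (k1 + delta * k2) by ring.
  have -> : 2 * (k1 + k2) * M * (s * N2) = 2 * M * (s * N ^+ 2) * (k1 + k2) by rewrite NN; ring.
  rewrite ler_wpM2l//; first by rewrite NN mulr_ge0// mulr_ge0.
  by rewrite lerD2l ler_piMl// ltW.
have D2 : dotv w n2 <= c2 * (s * N2).
  by move: (C2 ler01); rewrite !mul1r => /le_trans; apply; rewrite -NN le_eqVlt; apply/orP; left; apply/eqP; ring.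
have D3 : delta * dotv n1 (J *m w) <= M * (s * N2).
  apply: (le_trans (C3 d0)); rewrite -NN.
  have -> : s * N * (M * N) = M * (s * N ^+ 2) by ring.
  by rewrite ler_piMl// NN mulr_ge0.
have D4 : delta * dotv z n2 <= c2 * (s * N2).
  apply: (le_trans (C4 d0)); rewrite -NN.
  have -> : N * (c2 * s * N) = c2 * (s * N ^+ 2) by ring.
  by rewrite ler_piMl// NN mulr_ge0.
move: main C5 C6 D1 D2 D3 D4.
rewrite !mulrDl mulNr -!(mulrA _ s N2) -!(mulrA eps _ N2) !mulrDl !mul1r.
lra.
Qed.

Lemma lyapunov_correction_le (eps : R) Delta z w : 0 <= eps -> mx_bounded _ M Delta ->
  `|eps * dotv (w + delta *: z) (Delta *m feedback k1 k2 z w)|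
    <= eps * (2 * M * (k1 + k2)) * size2 z w.
Proof.
move=> eps0 DM.
have NN : Num.sqrt (size2 z w) ^+ 2 = size2 z w by rewrite sqr_sqrtr// size2_ge0.
have [zN wN] := enorm_le_size z w; have N0 := sqrtr_ge0 (size2 z w).
rewrite -NN normrM ger0_norm// -mulrA ler_wpM2l//.
move: (Num.sqrt _) zN wN N0 => N zN wN N0.
have -> : 2 * M * (k1 + k2) * N ^+ 2 = (N + N) * (M * (k1 * N + k2 * N)) by ring.
apply: dotv_le; last first.
  by apply: enorm_mulmx_le_trans; [exact: ltW|done|exact: enorm_feedback_le].
apply: enormD_le => //; apply: (le_trans (enormZ_le _ _ _ _ (ltW delta0) zN)).
by rewrite ler_piMl.
Qed.

Lemma cross_term_le z w : `|delta * dotv z (J *m w)| <= delta * M / 2 * size2 z w.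
Proof.
rewrite normrM gtr0_norm// -!mulrA ler_pM2l//.
apply: (le_trans (dotv_mulmx_le _ _ _ z w JM)); rewrite ler_pM2l//.
rewrite /size2 -!enorm_sqr; have := sqr_ge0 (enorm z - enorm w); rewrite sqrrB; lra.
Qed.

(** The cross term takes at most one half of the energy and the [eps]
correction at most one quarter. *)
Lemma lyapunov_ge (eps p : R) Delta z w : 0 <= eps -> mx_bounded _ M Delta ->
  eps * (2 * M * (k1 + k2)) <= Num.min (k1 * g) (Jm / 2) / 4 ->
  Num.min (k1 * g) (Jm / 2) / 4 * size2 z w + p * p
    <= lyapunov G J k1 k2 delta eps Delta z w p.
Proof.
move=> eps0 DM epsM; set b := Num.min _ _ in epsM *.
have b1 : b <= k1 * g by rewrite /b ge_min lexx.
have b2 : b <= Jm / 2 by rewrite /b ge_min lexx orbT.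
have db : delta * M <= b by rewrite /b le_min dk1 dJ.
have S0 := size2_ge0 z w.
have := lyapunov_correction_le eps Delta z w eps0 DM; have := cross_term_le z w.
rewrite !ler_norml => /andP[ct _] /andP[cc _].
have z2 := dotv_ge0 z; have w2 := dotv_ge0 w.
have zGz : 0 <= dotv z (G *m z) by apply: le_trans (gG z); rewrite mulr_ge0// ltW.
have h1 : k1 * (g * dotv z z) <= k1 * dotv z (G *m z) by rewrite ler_pM2l.
have h1' : 0 <= delta * k2 * dotv z (G *m z) by rewrite !mulr_ge0// ltW.
have h2 := JmJ w.
have h3 := ler_wpM2r S0 epsM.
have h4 := ler_wpM2r S0 db.
have h5 := ler_wpM2r z2 b1; have h6 := ler_wpM2r w2 b2.
rewrite /lyapunov; move: ct cc h3 h4 h5 h6; rewrite /size2 => ct cc h3 h4 h5 h6.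
lra.
Qed.

Lemma lyapunov_le (eps p : R) Delta z w : 0 <= eps -> eps <= 1 -> mx_bounded _ M Delta ->
  lyapunov G J k1 k2 delta eps Delta z w p
    <= (k1 + k2 + 1 + 2 * (k1 + k2)) * M * size2 z w + p * p.
Proof.
move=> eps0 eps1 DM.
have S0 := size2_ge0 z w.
have := lyapunov_correction_le eps Delta z w eps0 DM; have := cross_term_le z w.
rewrite !ler_norml => /andP[_ ct] /andP[_ cc].
have z2 := dotv_ge0 z; have w2 := dotv_ge0 w.
have h1 : dotv z (G *m z) <= M * dotv z z.
  have := dotv_mulmx_le _ _ _ z z GM; rewrite -expr2 enorm_sqr.
  by move=> /(le_trans (ler_norm _)).
have h2 : dotv w (J *m w) <= M * dotv w w.
  have := dotv_mulmx_le _ _ _ w w JM; rewrite -expr2 enorm_sqr.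
  by move=> /(le_trans (ler_norm _)).
have kk : k1 + delta * k2 <= k1 + k2 by rewrite lerD2l ler_piMl// ltW.
have zGz : 0 <= dotv z (G *m z) by apply: le_trans (gG z); rewrite mulr_ge0// ltW.
have h3 := ler_wpM2r zGz kk.
have kk0 : 0 <= k1 + k2 by rewrite addr_ge0// ltW.
have h4 := ler_wpM2l kk0 h1.
have MS0 : 0 <= M * size2 z w by rewrite mulr_ge0// ltW.
have h5 : eps * (2 * M * (k1 + k2)) * size2 z w <= 2 * (k1 + k2) * M * size2 z w.
  have -> : eps * (2 * M * (k1 + k2)) * size2 z w
    = eps * (2 * (k1 + k2) * M * size2 z w) by ring.
  by rewrite ler_piMl// -mulrA mulr_ge0// mulr_ge0.
have h6 : delta * M / 2 * size2 z w <= M / 2 * size2 z w.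
  by rewrite ler_wpM2r// ler_wpM2r// ler_piMl// ltW.
have h7 : (k1 + k2) * (M * dotv z z) <= (k1 + k2) * (M * size2 z w).
  by rewrite ler_wpM2l// ler_pM2l// lerDl.
have h8 : M * dotv w w <= M * size2 z w by rewrite ler_pM2l// lerDr.
rewrite /lyapunov; lra.
Qed.

End EnergyEstimates.

(** * Attitude dynamics in the slow variables *)

Section AttitudeDynamics.
Context {R : realType}.
Implicit Types (q : 'cV[R]_(3 + 1)) (omega z w : 'cV[R]_3) (x v : 'cV[R]_(3 + 1 + 3)).

Lemma dotv_quaternion q q' : dotv q q' = dotv (qvec q) (qvec q') + qscal q * qscal q'.
Proof.
rewrite -{1}(vsubmxK q) -{1}(vsubmxK q') dotv_col_mx.
by congr (_ + _); rewrite dotvE big_ord1.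
Qed.

Lemma qvec_kinematic q omega :
  qvec (kinematic_mx q *m omega) = 2^-1 *: (qscal q *: omega + crossmx (qvec q) *m omega).
Proof.
rewrite /qvec /kinematic_mx -scalemxAl mul_col_mx linearZ /= col_mxKu.
by rewrite mulmxDl mul_scalar_mx.
Qed.

Lemma qscal_kinematic q omega :
  qscal (kinematic_mx q *m omega) = - (2^-1 * dotv (qvec q) omega).
Proof.
by rewrite /qscal /kinematic_mx -scalemxAl mul_col_mx linearZ /= col_mxKd mxE mulNmx mxE mulrN.
Qed.

Lemma dotv_kinematic q omega : dotv q (kinematic_mx q *m omega) = 0.
Proof.
rewrite dotv_quaternion qvec_kinematic qscal_kinematic dotvZr dotvDr dotvZr.
by rewrite dotv_crossmx_self; ring.
Qed.

Lemma enorm_error_sqr x : enorm (x - attitude_equilibrium) ^+ 2 =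
  dotv (qvec (usubmx x)) (qvec (usubmx x))
  + (1 - qscal (usubmx x)) * (1 - qscal (usubmx x)) + dotv (dsubmx x) (dsubmx x).
Proof.
rewrite enorm_sqr -{1 2}(vsubmxK x) -{1 2}(vsubmxK (usubmx x)).
rewrite /attitude_equilibrium /qbar !opp_col_mx !add_col_mx !dotv_col_mx oppr0 !addr0.
congr (_ + _ + _); rewrite /qscal; move: (dsubmx (usubmx x)) => d.
by rewrite dotvE big_ord1 !mxE eqxx mulr1n; ring.
Qed.

Lemma attitude_spaceE x : attitude_space x <->
  dotv (qvec (usubmx x)) (qvec (usubmx x)) + qscal (usubmx x) ^+ 2 = 1.
Proof.
rewrite expr2 -dotv_quaternion /attitude_space /= /enorm; split=> [h|->]; last by rewrite sqrtr1.
by rewrite -enorm_sqr /enorm h expr1n.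
Qed.

(** With [a] equal to minus or plus twice the scalar part, the matrix is
[attitude_mx q] or its transpose.  The constant 10 adds up 3 from the scalar
part, 1 and 2 from the quadratic terms in the vector part, and 4 from the
cross product. *)
Lemma small_rotation_le q (v : 'cV[R]_3) (s a : R) :
  enorm (qvec q) <= s -> `|1 - qscal q| <= s -> s <= 1 -> `|a| <= 4 ->
  enorm (((qscal q ^+ 2 - dotv (qvec q) (qvec q))%:M + 2%:R *: (qvec q *m (qvec q)^T)
          + a *: crossmx (qvec q)) *m v - v) <= 10 * s * enorm v.
Proof.
move=> zs ps s1 a4; have s0 : 0 <= s by apply: le_trans ps.
set z := qvec q in zs *; move: (qscal q) ps => r ps.
have v0 := enorm_ge0 v; have z0 := enorm_ge0 z.
rewrite !mulmxDl mul_scalar_mx -!scalemxAl -mulmxA.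
have -> : z *m (z^T *m v) = dotv z v *: z.
  by rewrite [z^T *m v]mx11_scalar mul_mx_scalar.
rewrite addrAC (addrAC (_ *: v)) -(addrA (_ - v)) -{2}[v]scale1r -scalerBl.
have h1 : enorm ((r ^+ 2 - dotv z z - 1) *: v) <= 4 * s * enorm v.
  rewrite enormZ ler_wpM2r//.
  have r1 : `|(r - 1) * (r + 1)| <= s * 3.
    rewrite normrM distrC; apply: ler_pM => //.
    by move: ps; rewrite !ler_norml; lra.
  have zz : dotv z z <= s by rewrite -enorm_sqr expr2 (le_trans (ler_pM _ _ zs zs))// ler_piMl.
  have zz0 := dotv_ge0 z.
  have -> : r ^+ 2 - dotv z z - 1 = (r - 1) * (r + 1) - dotv z z by ring.
  apply: (le_trans (ler_normB _ _)); rewrite (ger0_norm zz0); lra.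
have h2 : enorm (2%:R *: (dotv z v *: z)) <= 2 * s * enorm v.
  rewrite enormZ ger0_norm// enormZ -mulrA ler_pM2l//.
  have := cauchy_schwarz _ z v => cs.
  apply: (@le_trans _ _ (enorm z * enorm v * enorm z)); first by rewrite ler_wpM2r.
  rewrite mulrAC ler_wpM2r//; apply: (@le_trans _ _ (s * 1)); last by rewrite mulr1.
  by apply: ler_pM => //; exact: le_trans s1.
have h3 : enorm (a *: (crossmx z *m v)) <= 4 * s * enorm v.
  rewrite enormZ -mulrA; apply: ler_pM => //; first exact: enorm_ge0.
  by apply: (le_trans (enorm_crossmx_le _ _)); rewrite ler_wpM2r.
apply: (le_trans (enormD _ _ _)).
apply: (le_trans (lerD h1 (le_trans (enormD _ _ _) (lerD h2 h3)))).
by rewrite -!mulrDl; congr (_ <= _): (lexx (10 * s * enorm v)); ring.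
Qed.

Lemma attitude_mx_tr q : (attitude_mx q)^T =
  (qscal q ^+ 2 - dotv (qvec q) (qvec q))%:M + 2%:R *: (qvec q *m (qvec q)^T)
  + (2%:R * qscal q) *: crossmx (qvec q).
Proof.
rewrite /attitude_mx !linearD /= !linearN /= !linearZ /= tr_scalar_mx trmx_mul trmxK tr_crossmx.
by rewrite opprK.
Qed.

(** Both attitude matrices are within [10 * s] of the identity and have norm at
most 11, and 120 is [10 * 11 + 10]. *)
Lemma attitude_conjugation_le q (K : 'M[R]_3) y (s M : R) :
  enorm (qvec q) <= s -> `|1 - qscal q| <= s -> s <= 1 -> 0 <= M -> mx_bounded _ M K ->
  enorm (attitude_mx q *m K *m (attitude_mx q)^T *m y - K *m y) <= 120 * M * s * enorm y.
Proof.
move=> zs ps s1 M0 KM; have s0 : 0 <= s by apply: le_trans ps.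
have r4 : `|2%:R * qscal q| <= 4 by move: ps; rewrite !ler_norml; lra.
have A1 u : enorm (attitude_mx q *m u - u) <= 10 * s * enorm u.
  by rewrite /attitude_mx -scaleNr; apply: small_rotation_le => //; rewrite normrN.
have A2 u : enorm ((attitude_mx q)^T *m u - u) <= 10 * s * enorm u.
  by rewrite attitude_mx_tr; exact: small_rotation_le.
move: (attitude_mx q) A1 A2 => A A1 A2.
have y0 := enorm_ge0 y.
have Ay : enorm (A^T *m y) <= 11 * enorm y.
  rewrite -[A^T *m y](subrK y); apply: (le_trans (enormD _ _ _)).
  apply: (le_trans (lerD (A2 y) (lexx _))).
  have : s * enorm y <= enorm y by rewrite ler_piMl.
  by rewrite -mulrA; lra.
have KAy : enorm (K *m (A^T *m y)) <= M * (11 * enorm y) by exact: enorm_mulmx_le_trans.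
have -> : A *m K *m A^T *m y - K *m y =
    (A *m (K *m (A^T *m y)) - K *m (A^T *m y)) + K *m (A^T *m y - y).
  by rewrite mulmxBr addrA subrK !mulmxA.
apply: (le_trans (enormD _ _ _)).
have h1 := enorm_mulmx_le_trans _ _ _ _ _ M0 KM (A2 y).
have h2 : enorm (A *m (K *m (A^T *m y)) - K *m (A^T *m y)) <= 10 * s * (M * (11 * enorm y)).
  by apply: (le_trans (A1 _)); rewrite ler_wpM2l// mulr_ge0.
apply: (le_trans (lerD h2 h1)); rewrite le_eqVlt; apply/orP; left; apply/eqP; ring.
Qed.

(** The gyroscopic torque contributes 1, the difference between the magnetic
matrix in body and inertial frames the rest. *)
Definition residual_bound (M k1 k2 : R) : R := M * (1 + 120 * (k1 + k2)).

Lemma residual_bound_gt0 M k1 k2 : 0 < M -> 0 < k1 -> 0 < k2 -> 0 < residual_bound M k1 k2.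
Proof. by move=> M0 k10 k20; rewrite mulr_gt0//; lra. Qed.

Definition slow_accel_bound (M Jm k1 k2 : R) : R :=
  (M * (k1 + k2) + residual_bound M k1 k2) / Jm.

Lemma slow_accel_bound_gt0 M Jm k1 k2 : 0 < M -> 0 < Jm -> 0 < k1 -> 0 < k2 ->
  0 < slow_accel_bound M Jm k1 k2.
Proof.
move=> M0 Jm0 k10 k20; rewrite divr_gt0// addr_gt0//; last exact: residual_bound_gt0.
by rewrite mulr_gt0// addr_gt0.
Qed.

(** In the slow variables [z] and [w = omega / eps] the closed loop becomes
[z' = eps * zeta] and [w' = eps * eta], where [zeta] and [eta] are, up to
residuals quadratic in the state, the right-hand sides of the linearized
system, which does not involve [eps]. *)
Lemma slow_dynamics (J : 'M[R]_3) (k1 k2 eps t s M Jm : R) (Gam : R -> 'M[R]_3) x v :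
  0 < eps -> 0 < k1 -> 0 < k2 -> 0 < M -> 0 < Jm ->
  (forall u, Jm * dotv u u <= dotv u (J *m u)) -> mx_bounded _ M J ->
  mx_bounded _ M (Gam t) ->
  let z := qvec (usubmx x) in let w := eps^-1 *: dsubmx x in
  let p := 1 - qscal (usubmx x) in
  let N := Num.sqrt (size2 z w) in
  enorm z <= s -> enorm w <= s -> `|p| <= s -> s <= 1 ->
  closed_loop Gam J k1 k2 eps t x v ->
  exists zeta eta n1 n2 : 'cV[R]_3,
    [/\ qvec (usubmx v) = eps *: zeta, eps^-1 *: dsubmx v = eps *: eta,
        zeta = 2^-1 *: w + n1 & J *m eta = - (Gam t *m feedback k1 k2 z w) + n2] /\
    [/\ enorm n1 <= s * N, enorm n2 <= residual_bound M k1 k2 * s * N &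
        enorm eta <= slow_accel_bound M Jm k1 k2 * N].
Proof.
move=> eps0 k10 k20 M0 Jm0 JmJ JM GM z w p N zs ws ps s1 [hq hw].
have eps_neq0 : eps != 0 by rewrite gt_eqF.
have s0 : 0 <= s by apply: le_trans ps.
have [zN wN] := enorm_le_size z w; rewrite -/N in zN wN.
have N0 : 0 <= N by exact: sqrtr_ge0.
have omegaE : dsubmx x = eps *: w by rewrite /w scalerA divff// scale1r.
clearbody w.
have kk : 0 < k1 + k2 by rewrite addr_gt0.
pose y := feedback k1 k2 z w.
have yN : enorm y <= (k1 + k2) * N.
  by rewrite mulrDl; exact: enorm_feedback_le.
pose n1 := 2^-1 *: (- p *: w + crossmx z *m w).
pose n2 := - (crossmx w *m J *m w)
  - (attitude_mx (usubmx x) *m Gam t *m (attitude_mx (usubmx x))^T *m y - Gam t *m y).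
pose eta := (eps ^+ 2)^-1 *: dsubmx v.
have Jeta : J *m eta = - (Gam t *m y) + n2.
  rewrite /eta -scalemxAr hw omegaE.
  have -> : pd_control k1 k2 eps (usubmx x) (eps *: w) = - (eps ^+ 2 *: y).
    by rewrite /pd_control /y /feedback -/z scalerDr !scalerA; congr (- (_ + _ *: _)); ring.
  have -> : crossmx (eps *: w) = eps *: crossmx w.
    apply/matrixP => i j; rewrite !mxE.
    by case: i => [[|[|[|]]]]// ?; case: j => [[|[|[|]]]]// ?; rewrite /= ?mulr0 ?mulrN.
  have -> : eps *: crossmx w *m J *m (eps *: w) = eps ^+ 2 *: (crossmx w *m J *m w).
    by rewrite -scalemxAr -!scalemxAl scalerA expr2.
  rewrite mulmxN -scalemxAr -opprD -scalerDr scalerN scalerA mulVf ?expf_neq0// scale1r.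
  by rewrite /n2 opprB addrCA addKr opprD.
exists (2^-1 *: w + n1), eta, n1, n2; split; first split=> //.
- have E : w + (- p *: w + crossmx z *m w) = qscal (usubmx x) *: w + crossmx z *m w.
    by rewrite addrA -{1}[w]scale1r -scalerDl /p opprB (addrC 1) subrK.
  rewrite hq qvec_kinematic omegaE -/z -scalemxAr (scalerA (qscal _)) (mulrC (qscal _)).
  by rewrite -scalerA -scalerDr /n1 -scalerDr E !scalerA mulrC.
- rewrite /eta scalerA; congr (_ *: _); by field.
have n2N : enorm n2 <= residual_bound M k1 k2 * s * N.
  rewrite /n2; apply: (@le_trans _ _ (s * (M * N) + 120 * M * s * ((k1 + k2) * N))); last first.
    by rewrite /residual_bound le_eqVlt; apply/orP; left; apply/eqP; ring.
  apply: enormD_le; rewrite enormN.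
    rewrite -mulmxA; apply: (le_trans (enorm_crossmx_le _ _)).
    by apply: ler_pM; rewrite ?enorm_ge0//; apply: enorm_mulmx_le_trans => //; exact: ltW.
  apply: (le_trans (attitude_conjugation_le _ _ _ _ _ zs ps s1 (ltW M0) GM)).
  by rewrite ler_wpM2l// !mulr_ge0// ltW.
split=> //.
  rewrite /n1; apply: (@le_trans _ _ (2^-1 * (s * N + s * N))); last first.
    by rewrite le_eqVlt; apply/orP; left; apply/eqP; field.
  apply: enormZ_le => //; apply: enormD_le.
    by rewrite enormZ normrN; apply: ler_pM; rewrite ?enorm_ge0.
  by apply: (le_trans (enorm_crossmx_le _ _)); apply: ler_pM; rewrite ?enorm_ge0.
have c20 := ltW (residual_bound_gt0 _ _ _ M0 k10 k20).
have JN : enorm (J *m eta) <= (M * (k1 + k2) + residual_bound M k1 k2) * N.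
  rewrite Jeta mulrDl; apply: enormD_le.
    by rewrite enormN -mulrA; apply: enorm_mulmx_le_trans => //; exact: ltW.
  by apply: (le_trans n2N); rewrite ler_wpM2r// ler_piMr.
rewrite /slow_accel_bound mulrAC ler_pdivlMr//.
apply: le_trans JN.
have [->|eta0] := eqVneq eta 0; first by rewrite mulmx0 !enorm0 mul0r.
rewrite -(@ler_pM2l _ (enorm eta)) ?enorm_gt0//.
apply: le_trans (le_trans (ler_norm _) (cauchy_schwarz _ eta (J *m eta))).
by rewrite mulrA -expr2 enorm_sqr mulrC.
Qed.

End AttitudeDynamics.

(** * Local stability *)

Section LocalStability.
Local Open Scope classical_set_scope.
Local Open Scope ring_scope.
Context {R : realType}.
Local Notation continuous_entries :=
  (entrywise (fun f : R -> R => continuous f) _ _).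

Lemma continuous_algebra : function_algebra (fun f : R -> R => continuous f).
Proof.
split=> [c t|f g cf cg t|f g cf cg t]; first exact: cvg_cst.
  exact: (continuousD (cf t) (cg t)).
exact: (continuousM (cf t) (cg t)).
Qed.

(** On the unit sphere near the equilibrium the scalar part is determined by
the vector part, so decay need only be shown in the latter. *)
Lemma scalar_part_le (a r : R) : 0 <= a -> `|1 - r| <= 1 -> a + r ^+ 2 = 1 ->
  (1 - r) * (1 - r) <= a.
Proof.
rewrite ler_norml => a0 /andP[h1 h2] h.
have r0 : 0 <= r by lra.
have r1 : r <= 1 by rewrite -(@ler_pXn2r _ 2)// ?nnegrE// expr1n; lra.
have : 0 <= (1 - r) * r by rewrite mulr_ge0// subr_ge0.
by move: h; rewrite expr2; lra.
Qed.

Lemma entrywise_mx_derive_continuous m n (X X' : R -> 'M[R]_(m, n)) :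
  (forall t, mx_derive _ _ t X (X' t)) -> continuous_entries X.
Proof. by move=> dX i j t; exact: is_derive_continuous (dX t i j). Qed.

Variables (Gam D : R -> 'M[R]_3) (G J : 'M[R]_3) (k1 k2 delta eps g Jm M : R).
Hypotheses (Gsym : G^T = G) (Jsym : J^T = J).
Hypotheses (g0 : 0 < g) (M0 : 0 < M) (Jm0 : 0 < Jm).
Hypotheses (k1_gt0 : 0 < k1) (k2_gt0 : 0 < k2) (delta0 : 0 < delta) (delta1 : delta <= 1).
Hypothesis gG : forall v, g * dotv v v <= dotv v (G *m v).
Hypothesis JmJ : forall v, Jm * dotv v v <= dotv v (J *m v).
Hypotheses (GM : mx_bounded _ M G) (JM : mx_bounded _ M J).
Hypothesis GamM : forall t, mx_bounded _ M (Gam t).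
Hypothesis DM : forall t, mx_bounded _ M (D t).
Hypothesis dD : forall t, mx_derive _ _ t D (Gam t - G).
Hypotheses (dk2 : delta * M <= k2 * g) (dk1 : delta * M <= k1 * g) (dJ : delta * M <= Jm / 2).

Let rate := Num.min (k2 * g / 2) (delta * k1 * g).
Let coer := Num.min (k1 * g) (Jm / 2).
Let c2 := residual_bound M k1 k2.
Let c3 := slow_accel_bound M Jm k1 k2.

Hypotheses (eps0 : 0 < eps) (eps1 : eps <= 1).
Hypothesis eps_coer : eps * (2 * M * (k1 + k2)) <= coer / 4.
Hypothesis eps_rate :
  eps * ((c3 + 2) * (M * (k1 + k2)) + 2 * M * (2 * k1 + k2 * c3)) <= rate / 4.

Implicit Type x : R -> 'cV[R]_(3 + 1 + 3).

Lemma unit_quaternion_invariant x (t0 t : R) : t0 <= t ->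
  continuous_entries x ->
  attitude_space (x t0) ->
  (forall s, t0 < s < t -> exists v, mx_derive _ _ s x v /\
     closed_loop Gam J k1 k2 eps s (x s) v) ->
  attitude_space (x t).
Proof.
move=> t0t cx /attitude_spaceE; rewrite expr2 -dotv_quaternion => q0 dx.
apply/attitude_spaceE; rewrite expr2 -dotv_quaternion -q0.
have cq : continuous_entries (fun s => usubmx (x s)).
  exact: entrywise_usub.
have cqq := fun_alg_dotv _ continuous_algebra _ _ _ cq cq.
have dqq s : t0 < s < t -> is_derive s 1 (fun s => dotv (usubmx (x s)) (usubmx (x s))) 0.
  move=> /dx[v [dv [vq _]]]; have dq := mx_derive_usub _ _ _ _ _ _ dv.
  apply: is_derive_eq (is_derive1_dotv _ _ _ _ _ _ dq dq) _.
  by rewrite vq dotvC dotv_kinematic addr0.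
apply/eqP; rewrite eq_le; apply/andP; split.
  apply: (nonincreasing_endpoints _ _ _ t0t (continuous_subspaceT cqq)) => s /dqq ds.
  by exists 0.
pose h s := -1 * dotv (usubmx (x s)) (usubmx (x s)).
have ch : continuous h.
  exact: (fun_algM _ continuous_algebra _ _ (fun_alg_cst _ continuous_algebra (-1)) cqq).
suff : h t <= h t0 by rewrite /h; lra.
apply: (nonincreasing_endpoints _ _ _ t0t (continuous_subspaceT ch)) => s /dqq ds.
by exists (-1 * 0); split; [exact: is_derive1Z|rewrite mulr0].
Qed.

(** The equation of motion is required only while the error is less than 1, so
that the estimate covers solutions of the clipped system as well.  The barrier
principle applies to the Lyapunov function with a level [m] whose sublevel set
lies in that region and in the one where the residuals are dominated. *)
Lemma local_stability : exists c k gam : R, [/\ 0 < c, 0 < k, 0 < gam &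
  forall x (t0 : R), continuous_entries x ->
    attitude_space (x t0) -> enorm (x t0 - attitude_equilibrium) < c ->
    (forall t, t0 < t -> enorm (x t - attitude_equilibrium) < 1 ->
      exists v, mx_derive _ _ t x v /\ closed_loop Gam J k1 k2 eps t (x t) v) ->
    forall t, t0 <= t ->
      [/\ attitude_space (x t), enorm (x t - attitude_equilibrium) < 1 &
        enorm (x t - attitude_equilibrium) <=
          k * enorm (x t0 - attitude_equilibrium) * expR (- gam * (t - t0))]].
Proof.
have kk : 0 < k1 + k2 by rewrite addr_gt0.
have c20 : 0 < c2 by exact: residual_bound_gt0.
have c30 : 0 < c3 by exact: slow_accel_bound_gt0.
have rate0 : 0 < rate by rewrite /rate lt_min !mulr_gt0 ?invr_gt0.
have coer0 : 0 < coer by rewrite /coer lt_min mulr_gt0 ?divr_gt0.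
pose K1 := 2 * (k1 + k2) * M + 2 * c2 + M + 1.
have K10 : 0 < K1.
  have := mulr_gt0 kk M0; move: c20 M0; rewrite /K1 -(mulrA 2).
  by move: c2 (_ * M) => C2 kM; lra.
(* Below this size the residuals use up at most a quarter of the rate. *)
pose s := Num.min 1 (rate / (4 * K1)).
have s0 : 0 < s by rewrite /s lt_min ltr01 divr_gt0// mulr_gt0.
have s1 : s <= 1 by rewrite /s ge_min lexx.
have sK : K1 * s <= rate / 4.
  have : s <= rate / (4 * K1) by rewrite /s ge_min lexx orbT.
  by rewrite ler_pdivlMr ?mulr_gt0//; lra.
pose b := Num.min (coer / 4) 1.
have b0 : 0 < b by rewrite /b lt_min ltr01 divr_gt0.
pose K := (k1 + k2 + 1 + 2 * (k1 + k2)) * M + 1.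
have K0 : 1 <= K by rewrite /K lerDr mulr_ge0 ?ltW// !addr_gt0 ?mulr_gt0.
have Kp : 0 < K by apply: lt_le_trans K0.
have e2 : 0 < eps ^+ 2 by rewrite exprn_gt0.
pose gam := eps * (rate / 2) / K.
have gam0 : 0 < gam by rewrite /gam divr_gt0// mulr_gt0// divr_gt0.
(* The factor eps converts w = omega / eps back to omega. *)
pose c := eps * s * Num.sqrt (b / K).
have c0 : 0 < c by rewrite /c !mulr_gt0// sqrtr_gt0 divr_gt0.
pose k := Num.sqrt (K / b) / eps.
have k0 : 0 < k by rewrite /k divr_gt0// sqrtr_gt0 divr_gt0.
exists c, k, (gam / 4); split=> //; first by rewrite divr_gt0.
move=> x t0 cx S0 x0c dx.
have [z zE] : exists z, z = fun t : R => qvec (usubmx (x t)) by eexists.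
have [w wE] : exists w, w = fun t : R => eps^-1 *: dsubmx (x t) by eexists.
have [p pE] : exists p, p = fun t : R => 1 - qscal (usubmx (x t)) by eexists.
pose E t := size2 (z t) (w t) + p t * p t.
pose V t := lyapunov G J k1 k2 delta eps (D t) (z t) (w t) (p t).
pose err t := enorm (x t - attitude_equilibrium).
have err0 t : 0 <= err t by exact: enorm_ge0.
have eps_ge0 := ltW eps0.
have omegaE t : dotv (dsubmx (x t)) (dsubmx (x t)) = eps ^+ 2 * dotv (w t) (w t).
  by rewrite wE dotvZl dotvZr; field; rewrite gt_eqF.
have errE t : err t ^+ 2 = dotv (z t) (z t) + p t * p t + eps ^+ 2 * dotv (w t) (w t).
  by rewrite /err enorm_error_sqr omegaE zE pE.
have pp0 t : 0 <= p t * p t by rewrite -expr2 sqr_ge0.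
have eps2_le1 : eps ^+ 2 <= 1 by rewrite exprn_ile1.
have err_le t : err t ^+ 2 <= E t.
  rewrite errE /E /size2.
  by rewrite [leRHS]addrAC lerD2l ler_piMl// dotv_ge0.
have E_le t : eps ^+ 2 * E t <= err t ^+ 2.
  rewrite errE /E /size2 !mulrDr.
  have h1 : eps ^+ 2 * dotv (z t) (z t) <= dotv (z t) (z t) by rewrite ler_piMl// dotv_ge0.
  have h2 : eps ^+ 2 * (p t * p t) <= p t * p t by rewrite ler_piMl.
  by rewrite addrAC; apply: lerD => //; apply: lerD.
have V_ge t : b * E t <= V t.
  have := lyapunov_ge G J k1 k2 delta g Jm M g0 M0 k1_gt0 k2_gt0 delta0 delta1 gG JmJ JM
    dk1 dJ eps (p t) (D t) (z t) (w t) eps_ge0 (DM t) eps_coer.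
  apply: le_trans; rewrite /E [leLHS]mulrDr lerD//.
    by rewrite ler_wpM2r ?size2_ge0// /b ge_min lexx.
  by rewrite ler_piMl// /b ge_min lexx orbT.
have V_le t : V t <= K * E t.
  have := lyapunov_le G J k1 k2 delta g M g0 M0 k1_gt0 k2_gt0 delta0 delta1 gG GM JM
    eps (p t) (D t) (z t) (w t) eps_ge0 eps1 (DM t).
  move=> /le_trans; apply; rewrite /E [leRHS]mulrDr lerD//.
    by rewrite ler_wpM2r ?size2_ge0// /K lerDl.
  by rewrite ler_peMl.
pose m := b * s ^+ 2.
have small t : V t < m -> [/\ enorm (z t) <= s, enorm (w t) <= s, `|p t| <= s & err t < 1].
  move=> Vm; have : b * E t < b * s ^+ 2 by apply: le_lt_trans Vm.
  rewrite ltr_pM2l// => Es.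
  have z2 := dotv_ge0 (z t); have w2 := dotv_ge0 (w t); have p2 := pp0 t.
  have Es' : E t <= s ^+ 2 by exact: ltW.
  split.
  - by apply: enorm_le; [exact: ltW|move: Es'; rewrite /E /size2; lra].
  - by apply: enorm_le; [exact: ltW|move: Es'; rewrite /E /size2; lra].
  - rewrite -(@ler_pXn2r _ 2)// ?nnegrE ?(ltW s0)// real_normK ?num_real// expr2.
    by move: Es'; rewrite /E /size2; lra.
  - rewrite -(@ltr_pXn2r _ 2)// ?nnegrE// expr1n.
    by apply: (le_lt_trans (err_le t)); apply: (lt_le_trans Es); rewrite exprn_ile1 ?(ltW s0).
have cont := continuous_algebra.
have cq : continuous_entries (fun t => usubmx (x t)).
  exact: entrywise_usub.
have cz : continuous_entries z by rewrite zE; exact: entrywise_usub.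
have cw : continuous_entries w.
  by rewrite wE; apply: (entrywiseZ _ cont); [exact: (fun_alg_cst _ cont)|exact: entrywise_dsub].
have cp : continuous p.
  rewrite pE.
  apply: (fun_algD _ cont (fun=> 1) (fun t => - qscal (usubmx (x t)))); first exact: (fun_alg_cst _ cont).
  by apply: (fun_algN _ cont); exact: (entrywise_dsub _ _ _ _ _ cq 0 0).
have cD : continuous_entries D.
  exact: entrywise_mx_derive_continuous dD.
have cst_mul a (f : R -> R) : continuous f -> continuous (fun t => a * f t).
  by move=> cf; apply: (fun_algM _ cont (fun=> a) f) => //; exact: (fun_alg_cst _ cont).
have cMul (A : 'M[R]_3) (f : R -> 'cV[R]_3) : continuous_entries f ->
    continuous_entries (fun t => A *m f t).
  by move=> cf; apply: (entrywiseM _ cont) => //; exact: (entrywise_cst _ cont).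
have cScale a (f : R -> 'cV[R]_3) : continuous_entries f ->
    continuous_entries (fun t => a *: f t).
  by move=> cf; apply: (entrywiseZ _ cont) => //; exact: (fun_alg_cst _ cont).
have cV : continuous V.
  rewrite /V /lyapunov /feedback.
  apply: (fun_algD _ cont (fun t => _ + _ + _ + _) (fun t => _)); last exact: (fun_algM _ cont).
  apply: (fun_algD _ cont (fun t => _ + _ + _) (fun t => _)).
    apply: (fun_algD _ cont (fun t => _ + _) (fun t => _)).
      apply: (fun_algD _ cont (fun t => _) (fun t => _)).
        by apply: cst_mul; apply: (fun_alg_dotv _ cont) => //; exact: cMul.
      by apply: cst_mul; apply: (fun_alg_dotv _ cont) => //; exact: cMul.
    by apply: cst_mul; apply: (fun_alg_dotv _ cont) => //; exact: cMul.
  apply: cst_mul; apply: (fun_alg_dotv _ cont).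
    by apply: (entrywiseD _ cont) => //; exact: cScale.
  by apply: (entrywiseM _ cont) => //; apply: (entrywiseD _ cont) => //; exact: cScale.
have V0m : V t0 < m.
  apply: (le_lt_trans (V_le t0)); rewrite -(@ltr_pM2l _ (eps ^+ 2))//.
  rewrite mulrCA; apply: (@le_lt_trans _ _ (K * err t0 ^+ 2)); first by rewrite ler_pM2l.
  have -> : eps ^+ 2 * m = K * c ^+ 2.
    rewrite /c /m !exprMn sqr_sqrtr ?divr_ge0 ?ltW//.
    by field; rewrite gt_eqF.
  by rewrite ltr_pM2l// ltr_pXn2r ?nnegrE// ltW.
have V00 : 0 <= V t0.
  by apply: le_trans (V_ge t0); rewrite mulr_ge0 ?(ltW b0)// addr_ge0 ?size2_ge0.
have sphere t : t0 <= t -> (forall r, t0 <= r <= t -> V r < m) -> attitude_space (x t).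
  move=> t0t Vr; apply: (unit_quaternion_invariant x t0) => // r /andP[t0r rt].
  have Vrm : V r < m by apply: Vr; rewrite !ltW.
  by have [_ _ _ er1] := small _ Vrm; exact: dx.
have decay (t : R) : t0 < t -> (forall r, t0 <= r <= t -> V r < m) ->
    exists d, is_derive t 1 V d /\ d <= - (gam / 2) * V t.
  move=> t0t Vr; have Vtm : V t < m by apply: Vr; rewrite lexx andbT ltW.
  have [zs ws ps er1] := small t Vtm.
  have [v [dv cl]] := dx t t0t er1.
  have slow := slow_dynamics J k1 k2 eps t s M Jm Gam (x t) v eps0 k1_gt0 k2_gt0 M0 Jm0
    JmJ JM (GamM t).
  have [zt wt pt] : [/\ qvec (usubmx (x t)) = z t, eps^-1 *: dsubmx (x t) = w t &
      1 - qscal (usubmx (x t)) = p t] by rewrite zE wE pE.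
  rewrite /= zt wt pt in slow.
  have [zeta [eta [n1 [n2 [[hz hw zetaE JE] [n1N n2N etaN]]]]]] := slow zs ws ps s1 cl.
  have dq := mx_derive_usub _ _ _ _ _ _ dv.
  have dz : mx_derive _ _ t z (eps *: zeta) by rewrite zE -hz; exact: mx_derive_usub.
  have dw : mx_derive _ _ t w (eps *: eta).
    by rewrite wE -hw; apply: mx_deriveZ; exact: mx_derive_dsub.
  have dp : is_derive t 1 p (eps * (2^-1 * dotv (z t) (w t))).
    have d4 := mx_derive_dsub _ _ _ _ _ _ dq 0 0.
    rewrite pE; apply: (is_derive_eq (is_derive1D _ _ _ _ _ (is_derive_cst (1 : R) t 1)
      (is_deriveN d4))).
    have -> : dsubmx (usubmx v) 0 0 = - (2^-1 * dotv (z t) (dsubmx (x t))).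
      by rewrite -/(qscal (usubmx v)) cl.1 qscal_kinematic zt.
    by rewrite add0r opprK -wt dotvZr; field; rewrite gt_eqF.
  exists (eps * lyapunov_rate G J k1 k2 delta eps (D t) (Gam t - G) (z t) (w t) (p t) zeta eta).
  split; first exact: (is_derive1_lyapunov _ _ _ _ _ _ _ _ (fun t => Gam t - G) _ _ _ _ _ (dD t) dz dw dp).
  have := lyapunov_rate_le G J k1 k2 delta g M Gsym Jsym M0 k1_gt0 k2_gt0 delta0
    delta1 gG GM JM dk2 eps (p t) s c2 c3 (D t) (Gam t) (z t) (w t) n1 n2 zeta eta
    eps_ge0 (ltW c20) (ltW c30) (DM t) zetaE JE s1 ps n1N n2N etaN.
  rewrite -/rate -/K1 => rle.
  have S2 := size2_ge0 (z t) (w t).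
  have rle' : lyapunov_rate G J k1 k2 delta eps (D t) (Gam t - G) (z t) (w t) (p t) zeta eta
      <= - (rate / 2) * size2 (z t) (w t).
    apply: (le_trans rle); rewrite ler_wpM2r// -addrA -lerBrDl.
    apply: (le_trans (lerD sK eps_rate)).
    by rewrite le_eqVlt; apply/orP; left; apply/eqP; field.
  have pz : p t * p t <= size2 (z t) (w t).
    have := sphere t (ltW t0t) Vr; move=> /attitude_spaceE; rewrite zt => sph.
    apply: (@le_trans _ _ (dotv (z t) (z t))); last by rewrite lerDl dotv_ge0.
    rewrite -pt; apply: (scalar_part_le _ _ (dotv_ge0 _) _ sph).
    by rewrite pt (le_trans ps).
  have VK : V t <= 2 * K * size2 (z t) (w t).
    apply: (le_trans (V_le t)); rewrite (mulrC 2) -mulrA ler_pM2l// /E.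
    by rewrite mulr_natl mulr2n lerD2l.
  have h1 := ler_wpM2l eps_ge0 rle'.
  apply: (le_trans h1); apply: (@le_trans _ _ (- (gam / 2) * (2 * K * size2 (z t) (w t)))); last first.
    by rewrite !mulNr lerN2 ler_wpM2l// divr_ge0// ltW.
  rewrite le_eqVlt; apply/orP; left; apply/eqP; rewrite /gam.
  by move: rate (size2 _ _) => a S; field; rewrite gt_eqF.
have half : 0 <= gam / 2 by rewrite divr_ge0// ltW.
have bar := barrier_exponential_decay V t0 m (gam / 2) half cV V00 V0m decay.
move=> t t0t; have [Vtm Vt] := bar t t0t.
have [_ _ _ er1] := small t Vtm.
split=> //.
  by apply: sphere => // r /andP[t0r _]; have [] := bar r t0r.
(* Square roots halve the rate of decay of the energy. *)
have X0 := expR_gt0 (- (gam / 4) * (t - t0)).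
have err_sq : b * err t ^+ 2 <= b * (k * err t0 * expR (- (gam / 4) * (t - t0))) ^+ 2.
  have XX : expR (- (gam / 4) * (t - t0)) ^+ 2 = expR (- (gam / 2) * (t - t0)).
    by rewrite expr2 -expRD; congr expR; field.
  apply: (@le_trans _ _ (V t)).
    by apply: le_trans (V_ge t); rewrite ler_pM2l.
  apply: (le_trans Vt); rewrite !exprMn XX mulrA ler_wpM2r ?expR_ge0//.
  apply: (le_trans (V_le t0)); rewrite ?exprMn sqr_sqrtr ?divr_ge0 ?(ltW Kp) ?(ltW b0)//.
  have -> : b * (K / b * eps^-1 ^+ 2 * err t0 ^+ 2) = K * (err t0 ^+ 2 / eps ^+ 2).
    by rewrite exprVn; field; rewrite !gt_eqF.
  by rewrite ler_pM2l// ler_pdivlMr// mulrC.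
have kX : 0 <= k * err t0 * expR (- (gam / 4) * (t - t0)).
  by apply: mulr_ge0; [apply: mulr_ge0 => //; exact: ltW|exact: ltW].
by move: err_sq; rewrite ler_pM2l// ler_pXn2r// nnegrE.
Qed.

End LocalStability.

(** * Solutions of the closed loop *)

Section Trajectories.
Local Open Scope classical_set_scope.
Local Open Scope ring_scope.
Context {R : realType}.

(** What a solution does before its initial time is unspecified; freezing it
there gives a function continuous on the whole line. *)
Lemma continuous_clamp (T : topologicalType) (x : R -> T) (t0 : R) :
  {within `[t0, +oo[, continuous x} -> continuous (fun t => x (Num.max t0 t)).
Proof.
move=> /subspace_continuousP cx t.
have t0m : (`[t0, +oo[%classic : set R) (Num.max t0 t).
  by rewrite /= in_itv /= andbT le_max lexx.
have cm : Num.max t0 s @[s --> t] --> Num.max t0 t.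
  by apply: (@continuous_max R R (fun=> t0) id); [exact: cvg_cst|exact: cvg_id].
move=> U /(cx _ t0m) xU; have xUt := cm _ xU.
suff : \forall s \near t, U (x (Num.max t0 s)) by [].
apply: (@filterS _ (nbhs t) _ _ _ _ xUt) => s /=; apply.
by rewrite /= in_itv /= andbT le_max lexx.
Qed.

Lemma is_derive_clamp (f : R -> R) (t0 t df : R) : t0 < t ->
  is_derive t 1 f df -> is_derive t 1 (fun s => f (Num.max t0 s)) df.
Proof.
move=> t0t dft; apply: (near_eq_is_derive _ dft).
by apply: filterS (lt_nbhsr t0t) => s t0s; rewrite max_r// ltW.
Qed.

Lemma mx_derive_derivable m n (x : R -> 'M[R]_(m, n)) (t : R) v :
  mx_derive _ _ t x v -> derivable x t 1 /\ 'D_1 x t = v.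
Proof.
move=> dx; have dxt : derivable x t 1.
  by apply/derivable_mxP => i j; case: (dx i j).
split=> //; rewrite derive_mx//; apply/matrixP => i j; rewrite mxE.
by case: (dx i j).
Qed.

Lemma derivable_mx_derive m n (x : R -> 'M[R]_(m, n)) (t : R) :
  derivable x t 1 -> mx_derive _ _ t x ('D_1 x t).
Proof.
move=> dx i j; rewrite derive_mx// mxE; apply: DeriveDef => //.
by move/derivable_mxP: dx; exact.
Qed.

End Trajectories.

Section ClosedLoopSolutions.
Local Open Scope classical_set_scope.
Local Open Scope ring_scope.
Context {R : realType}.
Local Notation continuous_entries :=
  (entrywise (fun f : R -> R => continuous f) _ _).

Definition closed_loop_field (Gam : R -> 'M[R]_3) (J : 'M[R]_3) (k1 k2 eps : R)
    (t : R) (x : 'cV[R]_(3 + 1 + 3)) : 'cV[R]_(3 + 1 + 3) :=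
  let q := usubmx x in
  let omega := dsubmx x in
  col_mx (kinematic_mx q *m omega)
    (invmx J *m (- (crossmx omega *m J *m omega)
       + attitude_mx q *m Gam t *m (attitude_mx q)^T *m pd_control k1 k2 eps q omega)).

Lemma closed_loop_fieldP Gam J k1 k2 eps t x : J \in unitmx ->
  closed_loop Gam J k1 k2 eps t x (closed_loop_field Gam J k1 k2 eps t x).
Proof. by move=> Ju; split; rewrite ?col_mxKu// col_mxKd mulKVmx. Qed.

Lemma tame_clipped_closed_loop (Gam : R -> 'M[R]_3) J k1 k2 eps :
  continuous_entries Gam ->
  (forall i j, exists B, forall t, `|Gam t i j| <= B) ->
  entrywise tame _ _ (fun a : R * 'cV[R]_(3 + 1 + 3) =>
    closed_loop_field Gam J k1 k2 eps a.1 (clip_col a.2)).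
Proof.
move=> cG bG; have alg := @tame_algebra R (3 + 1 + 3).
have cst n m (A : 'M[R]_(n, m)) : entrywise tame _ _ (fun _ : R * 'cV[R]_(3 + 1 + 3) => A).
  exact: (entrywise_cst _ alg).
have csts c : tame (fun _ : R * 'cV[R]_(3 + 1 + 3) => c) by exact: (fun_alg_cst _ alg).
have tx := @entrywise_tame_clip R (3 + 1 + 3).
have tq := entrywise_usub _ _ _ _ _ tx.
have to := entrywise_dsub _ _ _ _ _ tx.
have tz := entrywise_usub _ _ _ _ _ tq.
have tr : tame (fun a : R * 'cV[R]_(3 + 1 + 3) => qscal (usubmx (clip_col a.2))).
  exact: (entrywise_dsub _ _ _ _ _ tq 0 0).
have tG : entrywise tame _ _ (fun a : R * 'cV[R]_(3 + 1 + 3) => Gam a.1).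
  by move=> i j; exact: (tame_time (fun t => Gam t i j) (cG i j) (bG i j)).
have tA : entrywise tame _ _ (fun a : R * 'cV[R]_(3 + 1 + 3) =>
    attitude_mx (usubmx (clip_col a.2))).
  apply: (entrywiseD _ alg).
    apply: (entrywiseD _ alg).
      apply: (entrywise_scalar _ alg).
      apply: (fun_algD _ alg); first by apply: (fun_algM _ alg).
      by apply: (fun_algN _ alg); apply: (fun_alg_dotv _ alg).
    apply: (entrywiseZ _ alg) => //; apply: (entrywiseM _ alg) => //.
    exact: entrywise_tr.
  apply: (entrywiseN _ alg); apply: (entrywiseZ _ alg); first exact: (fun_algM _ alg).
  exact: (entrywise_crossmx _ alg).
apply: entrywise_col_mx.
  apply: (entrywiseM _ alg) => //; apply: (entrywiseZ _ alg) => //; apply: entrywise_col_mx.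
    apply: (entrywiseD _ alg); first exact: (entrywise_scalar _ alg).
    exact: (entrywise_crossmx _ alg).
  by apply: (entrywiseN _ alg); exact: entrywise_tr.
apply: (entrywiseM _ alg) => //; apply: (entrywiseD _ alg).
  apply: (entrywiseN _ alg); apply: (entrywiseM _ alg) => //; apply: (entrywiseM _ alg) => //.
  exact: (entrywise_crossmx _ alg).
apply: (entrywiseM _ alg).
  by apply: (entrywiseM _ alg); [exact: (entrywiseM _ alg)|exact: entrywise_tr].
apply: (entrywiseN _ alg); apply: (entrywiseD _ alg); exact: (entrywiseZ _ alg).
Qed.

Lemma enorm_attitude_equilibrium : enorm (attitude_equilibrium : 'cV[R]_(3 + 1 + 3)) = 1.
Proof.
rewrite /enorm /attitude_equilibrium /qbar !dotv_col_mx.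
have d0 n : dotv (0 : 'cV[R]_n) 0 = 0 by rewrite -enorm_sqr enorm0 expr0n.
by rewrite !d0 add0r addr0 dotvE big_ord1 mxE eqxx mulr1n mulr1 sqrtr1.
Qed.

Lemma clip_col_near_equilibrium (x : 'cV[R]_(3 + 1 + 3)) :
  enorm (x - attitude_equilibrium) < 1 -> clip_col x = x.
Proof.
move=> x1; apply/colP => i; rewrite mxE; apply: clip_id.
have := normr_coord_le_enorm (x - attitude_equilibrium) i; rewrite mxE mxE => h1.
have := normr_coord_le_enorm (attitude_equilibrium : 'cV[R]_(3 + 1 + 3)) i.
rewrite enorm_attitude_equilibrium => h2.
rewrite -[x i 0](subrK (attitude_equilibrium i 0)).
apply: (le_trans (ler_normD _ _)); rewrite (_ : 2 = 1 + 1)//.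
by apply: lerD => //; apply: (le_trans h1); exact: ltW.
Qed.

Lemma attitude_equilibriumP (Gam : R -> 'M[R]_3) J k1 k2 eps :
  equilibrium attitude_space (closed_loop Gam J k1 k2 eps) attitude_equilibrium.
Proof.
split.
  rewrite /attitude_space /= /attitude_equilibrium col_mxKu.
  have := enorm_attitude_equilibrium.
  by rewrite /enorm /attitude_equilibrium dotv_col_mx -(enorm_sqr 0) enorm0 expr0n addr0.
move=> t; rewrite /closed_loop /attitude_equilibrium col_mxKu col_mxKd.
split; first by rewrite mulmx0 linear0.
rewrite linear0 !mulmx0 oppr0 add0r.
by rewrite /pd_control /qvec /qbar col_mxKu !scaler0 addr0 oppr0 mulmx0.
Qed.

End ClosedLoopSolutions.

(** * The stability theorem *)

Section LocalToExponential.
Local Open Scope classical_set_scope.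
Local Open Scope ring_scope.
Context {R : realType}.
Local Notation continuous_entries :=
  (entrywise (fun f : R -> R => continuous f) _ _).

(** Both halves of the stability definition come from the same a priori
estimate: it applies to every true solution, and also to the solution of the
clipped system, which it confines to the region where clipping has no
effect. *)
Lemma exponentially_stable_of_estimate (Gam : R -> 'M[R]_3) (J : 'M[R]_3) (k1 k2 eps : R) :
  J \in unitmx ->
  continuous_entries Gam ->
  (forall i j, exists B, forall t, `|Gam t i j| <= B) ->
  (exists c k gam : R, [/\ 0 < c, 0 < k, 0 < gam &
    forall (x : R -> 'cV[R]_(3 + 1 + 3)) (t0 : R),
      continuous_entries x ->
      attitude_space (x t0) -> enorm (x t0 - attitude_equilibrium) < c ->
      (forall t, t0 < t -> enorm (x t - attitude_equilibrium) < 1 ->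
        exists v, mx_derive _ _ t x v /\ closed_loop Gam J k1 k2 eps t (x t) v) ->
      forall t, t0 <= t ->
        [/\ attitude_space (x t), enorm (x t - attitude_equilibrium) < 1 &
          enorm (x t - attitude_equilibrium) <=
            k * enorm (x t0 - attitude_equilibrium) * expR (- gam * (t - t0))]]) ->
  locally_exponentially_stable attitude_space
    (closed_loop Gam J k1 k2 eps) attitude_equilibrium.
Proof.
move=> Ju cG bG [c [k [gam [c0 k0 gam0 est]]]]; split; first exact: attitude_equilibriumP.
exists c, k, gam; split=> // t0 x0 _ Sx0 x0c.
have clampE (x : R -> 'cV[R]_(3 + 1 + 3)) : {within `[t0, +oo[, continuous x} ->
    continuous_entries (fun t => x (Num.max t0 t)).
  move=> /continuous_clamp cx i j s.
  apply: (@continuous_comp _ _ _ (fun t => x (Num.max t0 t))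
    (fun M : 'cV[R]_(3 + 1 + 3) => M i j)); first exact: cx.
  exact: coord_continuous.
split.
  have [X [X0 dX]] := tame_field_solution _ t0 x0
    (tame_clipped_closed_loop Gam J k1 k2 eps cG bG).
  have dXt t : t0 <= t -> mx_derive _ _ t X (closed_loop_field Gam J k1 k2 eps t (clip_col (X t))).
    by move=> t0t i j; have -> : j = 0 by [exact: ord1]; exact: dX.
  have cX : {within `[t0, +oo[, continuous X}.
    apply: continuous_in_subspaceT => t; rewrite inE /= in_itv /= andbT => t0t.
    apply: differentiable_continuous; apply/derivable1_diffP.
    by have [] := mx_derive_derivable _ _ _ _ _ (dXt t t0t).
  pose Y (t : R) := X (Num.max t0 t).
  have YE t : t0 <= t -> Y t = X t by move=> t0t; rewrite /Y max_r.
  have inv t : t0 <= t -> attitude_space (X t) /\ enorm (X t - attitude_equilibrium) < 1.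
    have cY : continuous_entries Y by exact: clampE.
    have dY r : t0 < r -> enorm (Y r - attitude_equilibrium) < 1 ->
        exists v, mx_derive _ _ r Y v /\ closed_loop Gam J k1 k2 eps r (Y r) v.
      move=> t0r; rewrite YE ?ltW// => err1.
      exists (closed_loop_field Gam J k1 k2 eps r (X r)); split; last exact: closed_loop_fieldP.
      move=> i j; apply: (is_derive_clamp (fun s => X s i j) _ _ _ t0r).
      by have := dXt r (ltW t0r) i j; rewrite clip_col_near_equilibrium.
    have SY : attitude_space (Y t0) by rewrite YE// X0.
    have Yc : enorm (Y t0 - attitude_equilibrium) < c by rewrite YE// X0.
    by move=> t0t; have [] := est Y t0 cY SY Yc dY t t0t; rewrite YE.
  exists X; split=> //.
    by move=> t t0t; have [] := inv t t0t.
  move=> t /ltW t0t; have [dXt1 ->] := mx_derive_derivable _ _ _ _ _ (dXt t t0t).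
  split=> //; have [_ err1] := inv t t0t; rewrite clip_col_near_equilibrium//.
  exact: closed_loop_fieldP.
move=> x [x0E cx Sx dx] t t0t.
pose Y (t : R) := x (Num.max t0 t).
have YE r : t0 <= r -> Y r = x r by move=> t0r; rewrite /Y max_r.
have cY : continuous_entries Y by exact: clampE.
have dY r : t0 < r -> enorm (Y r - attitude_equilibrium) < 1 ->
    exists v, mx_derive _ _ r Y v /\ closed_loop Gam J k1 k2 eps r (Y r) v.
  move=> t0r _; have [dxr cl] := dx r t0r; exists ('D_1 x r); rewrite YE ?ltW//; split=> // i j.
  by apply: (is_derive_clamp (fun s => x s i j) _ _ _ t0r); exact: derivable_mx_derive.
have SY : attitude_space (Y t0) by rewrite YE// x0E.
have Yc : enorm (Y t0 - attitude_equilibrium) < c by rewrite YE// x0E.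
by have [_ _] := est Y t0 cY SY Yc dY t t0t; rewrite !YE// x0E.
Qed.

End LocalToExponential.

Theorem theorem2 (R : realType) (p : dipole_orbit R) (Jmin Jmax k1 k2 : R)
    (hradius : 0 < orb_radius p) (hrate : 0 < orb_rate p)
    (hstrength : 0 < dip_strength p)
    (hJmin : 0 < Jmin) (hJmax : Jmin <= Jmax) (hk1 : 0 < k1) (hk2 : 0 < k2)
    (hGamma : posdef (Gamma_av p)) :
  exists eps_star : R, 0 < eps_star /\
    forall J : 'M[R]_3, posdef J ->
      Jmin <= lambda_min J -> lambda_min J <= lambda_max J ->
      lambda_max J = opnorm J -> opnorm J <= Jmax ->
    forall eps : R, 0 < eps -> eps < eps_star ->
      locally_exponentially_stable attitude_space
        (closed_loop (Gamma p) J k1 k2 eps) attitude_equilibrium.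
Proof.
have [g [g0 gG]] := posdef_lower_bound _ _ hGamma.
have [cG GamB] := Gamma_bounded p.
have [D [[cD DB] dD]] := Gamma_oscillation_primitive p.
(* One bound for all the matrices involved, uniform in time and in J. *)
pose M := 1 + cG *+ 3 *+ 3 + cD *+ 3 *+ 3 + \sum_i \sum_j `|Gamma_av p i j| + Jmax.
have cG0 : 0 <= cG *+ 3 *+ 3 by rewrite !mulrn_wge0//; apply: le_trans (GamB 0 0 0).
have cD0 : 0 <= cD *+ 3 *+ 3 by rewrite !mulrn_wge0//; apply: le_trans (DB 0 0 0).
have av0 : 0 <= \sum_i \sum_j `|Gamma_av p i j| by do 2!apply: sumr_ge0 => ? _.
have Jmax0 : 0 < Jmax by exact: lt_le_trans hJmax.
have M0 : 0 < M by rewrite /M; lra.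
have GamM t : mx_bounded _ M (Gamma p t).
  move=> v; apply: (le_trans (enorm_mulmx_le_const _ _ _ _ v (GamB t))).
  by rewrite ler_wpM2r ?enorm_ge0// /M; lra.
have DM t : mx_bounded _ M (D t).
  move=> v; apply: (le_trans (enorm_mulmx_le_const _ _ _ _ v (DB t))).
  by rewrite ler_wpM2r ?enorm_ge0// /M; lra.
have avM : mx_bounded _ M (Gamma_av p).
  move=> v; apply: (le_trans (enorm_mulmx_le _ _ _ v)).
  by rewrite ler_wpM2r ?enorm_ge0// /M; lra.
pose delta := Num.min 1 (Num.min (k2 * g / M) (Num.min (k1 * g / M) (Jmin / 2 / M))).
have delta0 : 0 < delta by rewrite /delta !lt_min ltr01 !divr_gt0 ?mulr_gt0.
have [delta1 dk2 dk1 dJ] : [/\ delta <= 1, delta * M <= k2 * g, delta * M <= k1 * g &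
    delta * M <= Jmin / 2].
  by rewrite -!ler_pdivlMr// /delta !ge_min !lexx !orbT.
(* The thresholds on eps are those at which the correction term costs a quarter
   of the coercivity, respectively of the decay rate, of the averaged energy. *)
pose coer := Num.min (k1 * g) (Jmin / 2).
have coer0 : 0 < coer by rewrite /coer lt_min mulr_gt0 ?divr_gt0.
pose rate := Num.min (k2 * g / 2) (delta * k1 * g).
have rate0 : 0 < rate by rewrite /rate lt_min ?divr_gt0 ?mulr_gt0.
pose L1 := 2 * M * (k1 + k2).
have kk : 0 < k1 + k2 by rewrite addr_gt0.
have L10 : 0 < L1 by rewrite /L1 !mulr_gt0.
pose c3 := slow_accel_bound M Jmin k1 k2.
have c30 : 0 < c3 by exact: slow_accel_bound_gt0.
pose L2 := (c3 + 2) * (M * (k1 + k2)) + 2 * M * (2 * k1 + k2 * c3).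
have L20 : 0 < L2.
  rewrite /L2; apply: addr_gt0; apply: mulr_gt0; rewrite ?mulr_gt0//.
    by apply: addr_gt0.
  by apply: addr_gt0; apply: mulr_gt0.
exists (Num.min 1 (Num.min (coer / 4 / L1) (rate / 4 / L2))); split.
  by rewrite !lt_min ltr01 !divr_gt0.
move=> J Jpos Jlow _ _ Jup eps eps0; rewrite !lt_min => /and3P[/ltW eps1 /ltW e1 /ltW e2].
rewrite ler_pdivlMr// in e1; rewrite ler_pdivlMr// in e2.
have tG := Gamma_trigpoly p.
apply: exponentially_stable_of_estimate.
- exact: posdef_unitmx.
- by move=> i j; exact: trigpoly_continuous.
- by move=> i j; exact: trigpoly_bounded.
apply: (@local_stability R (Gamma p) D (Gamma_av p) J k1 k2 delta eps g Jmin M) => //.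
- by case: hGamma.
- by case: Jpos.
- move=> v; apply: le_trans (lambda_min_le _ _ v Jpos).
  by rewrite ler_wpM2r// dotv_ge0.
- move=> v; apply: (le_trans (enorm_mulmx_le_opnorm _ _ _ v)).
  by rewrite ler_wpM2r ?enorm_ge0// (le_trans Jup)// /M; lra.
- by move=> t i j; apply: (is_derive_eq (dD t i j)); rewrite [RHS]mxE; congr (_ + _); rewrite [RHS]mxE.
Qed.
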